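(* Let $b\ge 2$ be an integer and let $w\neq 0^p$ be a word of length $p\ge1$ over the alphabet of digits $\{0,1,\dots,b-1\}$, with first digit $w_1$. Then $$I(b,w,0)=\sum_{m=0}^\infty(-1)^m\Bigl(\sum_{a=1}^{b-1}A_{m+1}(a)\int_{[0,1)}B_m(x)\,d\mu_0(x)-\mathbf 1_{\{w_1\neq0\}}\,A_{m+1}(n(w))\,\mathfrak R_{m+1}(b,w)\Bigr).$$ The series (with general term indexed by $m$ as displayed) is geometrically convergent.
   Context: Words and occurrences. Words are finite sequences (possibly empty) of digits in $\Sigma_b=\{0,\dots,b-1\}$; leading zeros are allowed. For a word $g$, $|g|$ is its length, $n(g)$ is the non-negative integer it represents in base $b$ (most significant digit on the left, $n(\text{empty})=0$), $x(g)=n(g)/b^{|g|}\in[0,1)$, and $\phi_g(t)=x(g)+b^{-|g|}t$. $0^p$ is the word made of $p$ zeros. $k_w(g)$ is the number of (possibly overlapping) occurrences of $w$ as a contiguous block in $g$, i.e. the number of starting indices. $I(b,w,0)$ is the sum of $1/n$ over all positive integers $n$ whose base-$b$ representation (without leading zeros) contains no occurrence of $w$. Languages attached to $w$: $\mathcal F$ is the set of words $g$ with $k_w(g)=0$ (including the empty word); $\mathcal R$ is the set of words $g$ (including the empty word) with $k_w(wg)=1$; $\mathcal G$ is the set of words $g$ such that $wg$ contains exactly two occurrences of $w$, the second one being terminal (a suffix of $wg$). Measures on $[0,1)$: $\mu_0=\sum_{g\in\mathcal F}b^{-|g|}\delta_{x(g)}$ and $\eta_0=\sum_{g\in\mathcal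 R}b^{-|g|}\delta_{x(g)}$ (both of finite total mass). For $j\ge1$, $\lambda_j(w)=\sum_{g\in\mathcal G}b^{-j|g|}$; one has $\lambda_1(w)=1$. $\nu_j$ is the unique Borel probability measure on $[0,1]$ with $\sum_{g\in\mathcal G}b^{-j|g|}(\phi_g)_*\nu_j=\lambda_j(w)\nu_j$ (so $\nu_1$ is Lebesgue measure); equivalently, the functional $\sigma_j(f)=\frac1{(j-1)!}\int_0^1 f^{(j-1)}\,d\nu_j$ is an eigenfunctional, with eigenvalue $\lambda_j(w)$, of the operator $(\mathsf K_wf)(x)=\sum_{g\in\mathcal G}b^{-|g|}f(\phi_g(x))$. For $m\ge0$, $B_m$ is the unique monic polynomial of degree $m$ with $\mathsf K_wB_m=\lambda_{m+1}(w)B_m$. For integers $j\ge1$, $n\ge1$: $A_j(n)=\int_0^1(n+x)^{-j}\,d\nu_j(x)$, and $\mathfrak R_j(b,w)=\int_{[0,1)}B_{j-1}(x)\,d\eta_0(x)$. $\mathbf 1_{\{w_1\ne0\}}$ is $1$ if $w_1\neq0$ and $0$ otherwise (in which case the corresponding term is absent). A series is geometrically convergent if its $m$-th term is $O(\theta^m)$ for some $0<\theta<1$. *)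

(* Defs.v *)
(* MathComp / MathComp-Analysis *)
From HB Require Import structures.
From mathcomp Require Import all_boot all_order all_algebra.
From mathcomp Require Import all_classical all_reals all_analysis.
Set Implicit Arguments.
Unset Strict Implicit.
Unset Printing Implicit Defensive.
Import Order.TTheory GRing.Theory Num.Theory.
Import numFieldNormedType.Exports.
Local Open Scope classical_set_scope.
Local Open Scope ring_scope.

(* The most significant digit comes first. *)
Definition word (b : nat) := seq 'I_b.

Section Words.
Variable b : nat.
Implicit Types w g : word b.

Definition nval g : nat := foldl (fun a (d : 'I_b) => (a * b + d)%N) 0%N g.

Definition first_digit g : nat := head 0%N [seq val d | d <- g].

Definition is_zero_word g : bool :=
  [seq val d | d <- g] == nseq (size g) 0%N.

(* k_w(g): the number of starting indices i of a block of g equal to w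
   (w is meant to be nonempty, so that i < |g|). *)
Definition occ w g : nat :=
  count (fun i => prefix w (drop i g)) (iota 0 (size g)).

Definition langF w : set (word b) := [set g | occ w g = 0%N].

Definition langR w : set (word b) := [set g | occ w (w ++ g) = 1%N].

Definition langG w : set (word b) :=
  [set g | occ w (w ++ g) = 2%N /\ suffix w (w ++ g)].

(* A nonzero first digit excludes both leading zeros and the empty word. *)
Definition base_repr (n : nat) g : Prop :=
  nval g = n /\ first_digit g <> 0%N.

Definition free_nat w : set nat :=
  [set n | (0 < n)%N /\ exists g, base_repr n g /\ occ w g = 0%N].

End Words.

Section Reals.
Variables (R : realType) (b : nat).
Implicit Types (w g : word b) (j m n : nat).

(* I(b,w,0), a priori an element of [0,+oo]. *)
Definition irwin w : \bar R := \esum_(n in free_nat w) (n%:R^-1)%:E.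

Definition xval g : R := (nval g)%:R / b%:R ^+ size g.

Definition phi g (t : R) : R := xval g + b%:R ^- size g * t.

Definition atomic (L : set (word b)) (A : set (measurableTypeR R)) : \bar R :=
  (\esum_(g in L) ((b%:R ^- size g)%:E * \d_(xval g : measurableTypeR R) A))%E.

Section AtomicMeasure.
Variable L : set (word b).
Local Open Scope ereal_scope.

Let wt_ge0 g (A : set (measurableTypeR R)) :
  0 <= (b%:R ^- size g)%:E * \d_(xval g : measurableTypeR R) A :> \bar R.
Proof. by rewrite mule_ge0// lee_fin invr_ge0 exprn_ge0. Qed.

Let atomic0 : atomic L set0 = 0.
Proof. by apply: esum1 => g _; rewrite measure0 mule0. Qed.

Let atomic_ge0 A : 0 <= atomic L A.
Proof. by apply: esum_ge0 => g _. Qed.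

Let atomic_sigma_additive : semi_sigma_additive (atomic L).
Proof.
move=> F mF tF mUF.
suff -> : atomic L (\bigcup_n F n) = \sum_(0 <= i <oo) atomic L (F i).
  exact: is_cvg_ereal_nneg_natsum.
rewrite nneseries_esumT//.
rewrite /atomic esum_esum; last by move=> *; exact: wt_ge0.
rewrite (@reindex_esum _ _ _ (L `*`` (fun=> [set: nat])) _
  (fun x : word b * nat => (x.2, x.1))); last 1 first.
- by split => [[g n] []//|[g n] [h k] _ _ [-> ->]//|[n g] [_ Lg]];
    exists (g, n).
- rewrite -(@esum_esum _ _ _ L (fun=> [set: nat])
    (fun g n => (b%:R ^- size g)%:E * \d_(xval g : measurableTypeR R) (F n)));
    last by move=> *; exact: wt_ge0.
  apply: eq_esum => g _.
  rewrite -(nneseries_esumT (a := fun n => _ * _)); last by move=> n; exact: wt_ge0.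
  rewrite nneseriesZl; last by move=> n _.
  congr *%E; apply/esym/cvg_lim => //.
  exact: measure_semi_sigma_additive.
Qed.

HB.instance Definition _ := isMeasure.Build _ _ _ (atomic L)
  atomic0 atomic_ge0 atomic_sigma_additive.

End AtomicMeasure.

Definition mu0 w : {measure set (measurableTypeR R) -> \bar R} :=
  atomic (langF w).

Definition eta0 w : {measure set (measurableTypeR R) -> \bar R} :=
  atomic (langR w).

(* The series converges: langG w is a prefix code, so it is at most 1 for
   j >= 1 by Kraft's inequality. *)
Definition lambda w j : R :=
  fine (\esum_(g in langG w) (b%:R ^- (j * size g))%:E)%E.

(* Unordered sum of a real family; the convention is only meaningful for an
   absolutely summable family. *)
Definition usum (T : choiceType) (D : set T) (f : T -> R) : R :=
  fine (\esum_(i in D) (f^\+ i)%:E)%E - fine (\esum_(i in D) (f^\- i)%:E)%E.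

Definition Kop w (f : R -> R) (x : R) : R :=
  usum (langG w) (fun g => b%:R ^- size g * f (phi g x)).

(* nu_j, viewed as a Borel probability on R carried by [0,1]. *)
Definition is_nu w j (nu : probability (measurableTypeR R) R) : Prop :=
  nu `[0%R, 1%R]%classic = 1%E /\
  forall A : set (measurableTypeR R), measurable A ->
    (\esum_(g in langG w) ((b%:R ^- (j * size g))%:E *
        pushforward nu (phi g : measurableTypeR R -> measurableTypeR R) A)
     = (lambda w j)%:E * nu A)%E.

Definition is_B w m (B : {poly R}) : Prop :=
  [/\ B \is monic, size B = m.+1 &
      forall x : R, 0 <= x <= 1 ->
        Kop w (horner B) x = lambda w m.+1 * B.[x]].

Definition Aint (nu : nat -> probability (measurableTypeR R) R) j n : R :=
  \int[nu j]_(x in `[0%R, 1%R]) (n%:R + x) ^- j.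

(* $\mathfrak R_j(b,w)$, for j >= 1. *)
Definition Rint w (B : nat -> {poly R}) j : R :=
  \int[eta0 w]_(x in `[0%R, 1%R[) (B j.-1).[x].

Definition term w (nu : nat -> probability (measurableTypeR R) R)
    (B : nat -> {poly R}) m : R :=
  (-1) ^+ m *
  (\sum_(1 <= a < b) Aint nu m.+1 a * \int[mu0 w]_(x in `[0%R, 1%R[) (B m).[x]
   - (first_digit w != 0%N)%:R * Aint nu m.+1 (nval w) * Rint w B m.+1).

End Reals.

(* Main.v *)
(** Removing the leading digit, and counting apart the words that start with w,
    gives I(b,w,0) = sum_a int 1/(a+x) dmu_0 - [w_1 <> 0] int 1/(n(w)+x) deta_0,
    so it is enough to expand 1/(n+x) = sum_m (-1)^m A_(m+1)(n) B_m(x) at a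
    geometric rate, uniformly on [0,1].

    The functionals sigma_j are biorthogonal to the B_m, hence every polynomial p
    is the finite sum of the sigma_(m+1)(p) B_m; this is applied to the partial
    sums of 1/(n+x) = sum_k (1-x)^k/(n+1)^(k+1), whose coefficients (-1)^m
    sigma_(m+1) increase to A_(m+1)(n).  No word of G represents 0, so nu_j lives
    on points phi_g(y) >= b^-|g| and A_m(n) = O(t^m) with t = b^l/(b^l+1), where
    l is the length of the shortest word g0 of G.

    What remains is that B_m grows on [0,1] more slowly than any exponential.
    Let c be the fixed point of phi_g0.  Expanding (x-c)^m in the B_j, where the
    moments of nu_(j+1) about c are O(b^-j), bounds the k-th derivative of B_m by
    ((1+d)r)^m on the ball of radius r about c, for r large.  Every word of G ends
    with g0, so that phi_g o phi_g0^-1 maps the balls of radius at least 1 into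
    themselves; reading the eigenvalue equation at phi_g0^-1(x) for k large then
    transfers the bound from r = b^(2l) to r = 1.  Lower derivatives follow since
    the i-th derivative of B_m has nu_(i+1)-mean zero for i < m. *)

Require Import Defs.
From mathcomp Require Import all_boot all_order all_algebra.
From mathcomp Require Import all_classical all_reals all_analysis.
From mathcomp Require Import measurable_realfun.
From mathcomp Require Import zify ring lra.
Set Implicit Arguments.
Unset Strict Implicit.
Unset Printing Implicit Defensive.
Import Order.TTheory GRing.Theory Num.Theory.
Import numFieldNormedType.Exports.
Local Open Scope classical_set_scope.
Local Open Scope ring_scope.

(** * Words and occurrences *)

Section Words.
Variables (b : nat) (w : word b).
Hypothesis w_gt0 : (0 < size w)%N.
Implicit Types g h u v : word b.

Lemma occ_cons x v : occ w (x :: v) = (prefix w (x :: v) + occ w v)%N.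
Proof.
rewrite /occ /= -[X in iota X _](addn0 1) iotaDl count_map.
by congr (_ + _)%N; apply: eq_count => i.
Qed.

Lemma prefix_rconsE v x : prefix w (rcons v x) = prefix w v || (w == rcons v x).
Proof.
apply/idP/orP => [/prefixP[s]|[|/eqP->]]; last first.
- exact: prefix_refl.
- by move=> h; apply: (prefix_trans h); rewrite -cats1 prefix_prefix.
case/lastP: s => [|s y]; first by rewrite cats0 => ->; right.
rewrite -rcons_cat => /eqP; rewrite eqseq_rcons => /andP[/eqP-> _].
by left; exact: prefix_prefix.
Qed.

Lemma suffix_consE x v : suffix w (x :: v) = (w == x :: v) || suffix w v.
Proof.
apply/idP/orP => [/suffixP[[|y s]] /=|[/eqP->|]].
- by move=> ->; left.
- by move=> [_ ->]; right; exact: suffix_suffix.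
- exact: suffix_refl.
- by move=> h; apply: (suffix_trans h); rewrite -cat1s suffix_suffix.
Qed.

Lemma occ_small v : (size v < size w)%N -> occ w v = 0%N.
Proof.
elim: v => [//|x v IH] vw; rewrite occ_cons IH ?addn0; last exact: ltn_trans vw.
by apply/eqP; rewrite eqb0; apply: contraL vw => /prefixP[s ->];
  rewrite size_cat -leqNgt leq_addr.
Qed.

Lemma size_prefix_le v : prefix w v -> (size w <= size v)%N.
Proof. by move=> /prefixP[s ->]; rewrite size_cat leq_addr. Qed.

Lemma size_suffix_le v : suffix w v -> (size w <= size v)%N.
Proof. by move=> /suffixP[s ->]; rewrite size_cat leq_addl. Qed.

(** [occ] recurses on the left; this mirror recursion isolates a terminal occurrence, as the
    definition of G requires. In the induction, an occurrence filling the whole word is at once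
    initial and terminal, and by length it excludes any shorter prefix or suffix equal to w. *)
Lemma occ_rcons v x : occ w (rcons v x) = (occ w v + suffix w (rcons v x))%N.
Proof.
elim: v => [|y v IH].
  rewrite [rcons _ _]/= occ_cons suffix_consE addn0 /=.
  rewrite (_ : occ w [::] = 0%N)// add0n.
  rewrite (_ : suffix w [::] = false); last first.
    by apply/negbTE/negP => /size_suffix_le /=; case: (w) w_gt0.
  rewrite orbF; congr nat_of_bool.
  by have := prefix_rconsE [::] x; rewrite /= => ->; case: (w) w_gt0.
rewrite rcons_cons !occ_cons IH suffix_consE -rcons_cons prefix_rconsE.
have hn s : prefix w s -> w == rcons s x = false.
  by move=> /size_prefix_le h; apply/negbTE/eqP => e; move: h;
    rewrite e size_rcons ltnn.
have hm : w == rcons (y :: v) x -> suffix w (rcons v x) = false.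
  by move=> /eqP e; apply/negbTE/negP => /size_suffix_le; rewrite e /= ltnn.
case: (boolP (prefix w (y :: v))) => [/hn ->|_] /=; first by lia.
by case: (boolP (w == _)) => [/hm ->|_] /=; lia.
Qed.

Lemma occ_catr u v : (occ w v <= occ w (u ++ v))%N.
Proof.
by elim: u => //= x u IH; rewrite occ_cons (leq_trans IH)// leq_addl.
Qed.

Lemma occ_self v : occ w (w ++ v) = (occ w (behead w ++ v)).+1.
Proof.
case: w w_gt0 (@occ_cons) => // x s _ H.
by rewrite [_ ++ _]/= H -cat_cons prefix_prefix.
Qed.

Lemma occ_ww : occ w w = 1%N.
Proof.
rewrite -[X in occ w X]cats0 occ_self cats0 occ_small//.
by rewrite size_behead ltn_predL.
Qed.

Lemma langR_langF v : langR w v -> langF w v.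
Proof.
rewrite /langR /langF /= occ_self => -[e]; apply/eqP.
by rewrite -leqn0 -e occ_catr.
Qed.

(** The occurrence at index 0 is always present in [w ++ v], so R only asks that nothing occurs
    later. In this form R appears when the words starting with w are split off from I(b,w,0). *)
Lemma langR_behead v : langR w v <-> langF w (behead w ++ v).
Proof. by rewrite /langR /langF /= occ_self; split=> [[]|->]. Qed.

Lemma langG_size_gt0 g : langG w g -> (0 < size g)%N.
Proof. by case: g => // -[]; rewrite cats0 occ_ww. Qed.

Lemma langG_rcons h x : langG w (rcons h x) -> langR w h.
Proof.
by move=> -[+ sw]; rewrite -rcons_cat occ_rcons rcons_cat sw addn1 => -[].
Qed.

(** Take the shortest prefix of w that creates a second occurrence when appended to w; all of w
    does, so the search ends. By minimality the new occurrence uses the last letter, hence is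
    terminal. *)
Lemma langG_short : exists2 g, langG w g & (size g <= size w)%N.
Proof.
have ex : exists k, (1 < occ w (w ++ take k w))%N.
  by exists (size w); rewrite take_size occ_self ltnS -occ_ww occ_catr.
case: (ex_minnP ex) => -[|k]; first by rewrite take0 cats0 occ_ww.
move=> hk mk.
have k_lt : (k < size w)%N.
  (* If k were at least |w|, [take k w] and [take k.+1 w] would both be w, against minimality. *)
  rewrite ltnNge; apply/negP => wk; move: hk (mk k); rewrite ltnn.
  by rewrite (take_oversize wk) (take_oversize (leqW wk)) => -> /(_ isT).
have [x ex'] : exists x, take k.+1 w = rcons (take k w) x.
  by case: w w_gt0 k_lt => // y s _ kl; exists (nth y (y :: s) k); rewrite -take_nth.
exists (take k.+1 w); last by rewrite size_take; case: ifP => // /ltnW.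
move: hk; rewrite /langG/= ex' -rcons_cat occ_rcons.
have := mk k; rewrite ltnn => /contraFN/(_ erefl); rewrite -leqNgt => h1.
case: suffix => /=; rewrite ?addn0 ?addn1; last by rewrite ltnNge h1.
by move=> h2; split => //; apply/eqP; rewrite eqSS eqn_leq h1.
Qed.

Lemma suffix_le (T : eqType) (s t v : seq T) :
  suffix s v -> suffix t v -> (size s <= size t)%N -> suffix s t.
Proof.
move=> /suffixP[s1 e1] /suffixP[t1 e2] st.
apply/suffixP; exists (drop (size t1) s1).
have h : (size t1 <= size s1)%N.
  by have := congr1 size e1; rewrite e2 !size_cat => ?; lia.
have := congr1 (drop (size t1)) e1.
by rewrite e2 drop_size_cat// drop_cat; case: ltngtP h => // -> _;
  rewrite subnn drop0 drop_size.
Qed.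

Lemma langG_suffix g0 g : langG w g0 -> langG w g -> (size g0 <= size w)%N ->
  (size g0 <= size g)%N -> suffix g0 g.
Proof.
move=> -[_ s0] -[_ s1] h0 h1.
have s2 : suffix g0 w by apply: suffix_le s0 h0; exact: suffix_suffix.
by apply: suffix_le (suffix_trans s2 s1) _ h1; exact: suffix_suffix.
Qed.

(* g0 is a shortest word of G: not longer than w, it is a suffix of w, hence of
   every g that is at least as long. *)
Lemma langG_shortest : exists2 g0, langG w g0 &
  forall g, langG w g -> exists2 u, g = u ++ g0 & (g <> g0 -> (0 < size u)%N).
Proof.
have [g1 G1 g1w] := langG_short.
have ex : exists l, `[< exists2 g, langG w g & size g = l >].
  by exists (size g1); apply/asboolP; exists g1.
case: (ex_minnP ex) => _ /asboolP[g0 G0 <-] m.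
exists g0 => // g G; have h h' : langG w h' -> (size g0 <= size h')%N.
  by move=> H; apply: m; apply/asboolP; exists h'.
have /suffixP[u gu] : suffix g0 g.
  by apply: langG_suffix => //; [exact: leq_trans (h g1 G1) g1w|exact: h].
by exists u => //; case: u gu => //= ->.
Qed.

End Words.

(** * Integers represented by words *)

Section Value.
Variable b : nat.
Hypothesis b_gt1 : (1 < b)%N.
Implicit Types g h u v : word b.

Lemma nval_rcons v x : nval (rcons v x) = (nval v * b + x)%N.
Proof. by rewrite /nval foldl_rcons. Qed.

Lemma nval_cat u v : nval (u ++ v) = (nval u * b ^ size v + nval v)%N.
Proof.
elim/last_ind: v => [|v x IH]; first by rewrite cats0 muln1 addn0.
by rewrite -rcons_cat !nval_rcons IH size_rcons expnS; lia.
Qed.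

Lemma nval_cons (x : 'I_b) v : nval (x :: v) = (x * b ^ size v + nval v)%N.
Proof. by rewrite -cat1s nval_cat /nval /= mul0n. Qed.

Lemma nval_lt v : (nval v < b ^ size v)%N.
Proof.
elim/last_ind: v => [//|v x IH]; rewrite nval_rcons size_rcons expnS.
rewrite [X in (_ < X)%N]mulnC (leq_trans _ (leq_mul IH (leqnn b)))//.
by rewrite mulSn addnC ltn_add2r ltn_ord.
Qed.

Lemma nval_inj u v : size u = size v -> nval u = nval v -> u = v.
Proof.
elim/last_ind: u v => [[]//|u x IH] v; case/lastP: v => [|v y].
  by rewrite size_rcons.
rewrite !size_rcons !nval_rcons => -[suv] e.
have := congr1 (modn^~ b) e; rewrite !modnMDl !modn_small// => xy.
have := congr1 (divn^~ b) e; rewrite !divnMDl ?(ltnW b_gt1)// !divn_small//.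
by rewrite !addn0 => /(IH _ suv) ->; congr rcons; exact: val_inj.
Qed.

Lemma nval_lead v : first_digit v <> 0%N -> (b ^ (size v).-1 <= nval v)%N.
Proof.
case: v => //= x v x0; rewrite nval_cons -[leqLHS]mul1n.
by rewrite (leq_trans _ (leq_addr _ _))// leq_mul2r lt0n; apply/orP; right;
  exact/eqP.
Qed.

(** Equal lengths are forced by b^(|v|-1) <= n(v) < b^|v|, and words of equal length are determined
    by their value. *)
Lemma nval_lead_inj u v : first_digit u <> 0%N -> first_digit v <> 0%N ->
  nval u = nval v -> u = v.
Proof.
move=> u0 v0 e; apply: nval_inj => //.
have aux (s t : word b) : first_digit s <> 0%N -> first_digit t <> 0%N ->
    nval s = nval t -> (size s <= size t)%N.
  move=> s0 t0 st; have := leq_ltn_trans (nval_lead s0).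
  move=> /(_ (b ^ size t)%N); rewrite st nval_lt => /(_ isT).
  rewrite ltn_exp2l//; case: s s0 {st} => //=.
by apply/eqP; rewrite eqn_leq !aux.
Qed.

Lemma nval_eq0 v : (nval v == 0)%N = is_zero_word v.
Proof.
rewrite /is_zero_word; elim/last_ind: v => [//|v x IH].
rewrite nval_rcons addn_eq0 muln_eq0 IH map_rcons size_rcons.
rewrite (_ : nseq (size v).+1 0%N = rcons (nseq (size v) 0%N) 0%N); last first.
  by elim: (size v) => //= n {1}->.
by rewrite eqseq_rcons (gtn_eqF (ltnW b_gt1)) orbF.
Qed.

(** Write wg = sw. If n(g) = 0, comparing values shows that b^|w| divides n(w)(b^|g| - 1), hence
    n(w) by coprimality; since n(w) < b^|w|, w would be a zero word. *)
Lemma nval_langG w g : (0 < size w)%N -> ~~ is_zero_word w -> langG w g ->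
  (0 < nval g)%N.
Proof.
move=> w0 wz G; rewrite lt0n; apply: contra wz => /eqP g0.
have [_ /suffixP[s]] := G.
move=> /(congr1 (@nval b)); rewrite !nval_cat g0 addn0 => e.
have g_gt0 := langG_size_gt0 w0 G.
have : (b ^ size w %| nval w * (b ^ size g - 1))%N.
  by apply/dvdnP; exists (nval s); rewrite mulnBr; lia.
rewrite Gauss_dvdl; last first.
  rewrite coprimeXl// subn1 -(coprime_pexpl _ _ g_gt0).
  by rewrite coprimenP// expn_gt0 ltnW.
by rewrite -nval_eq0 /dvdn modn_small// nval_lt.
Qed.

End Value.

(** * Countable sums *)

(* Unordered sums over D are read as series over the codes of its elements, so
   that partial sums make sense for polynomials too. *)
Definition cterm (T : countType) (V : nmodType) (D : set T) (f : T -> V)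
    (n : nat) : V :=
  if @pickle_inv T n is Some x then (if `[< D x >] then f x else 0) else 0.

Definition psum (T : countType) (V : nmodType) (D : set T) (f : T -> V)
    (N : nat) : V := \sum_(0 <= n < N) cterm D f n.

Section PsumAlgebra.
Variables (T : countType) (V : nmodType) (D : set T).
Implicit Types (f g : T -> V) (N : nat).

Lemma cterm_pickle f x : D x -> cterm D f (pickle x) = f x.
Proof. by move=> Dx; rewrite /cterm pickleK_inv; case: asboolP. Qed.

Lemma eq_psum f g : (forall x, D x -> f x = g x) -> psum D f =1 psum D g.
Proof.
move=> fg N; apply: eq_bigr => n _; rewrite /cterm.
by case: pickle_inv => // x; case: asboolP => // /fg.
Qed.

Lemma psum_raddf (W : nmodType) (h : {additive V -> W}) f N :
  h (psum D f N) = psum D (h \o f) N.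
Proof.
rewrite raddf_sum; apply: eq_bigr => n _; rewrite /cterm.
by case: pickle_inv => [x|]; [case: asboolP|]; rewrite // raddf0.
Qed.

Lemma psumD f g N : psum D (fun x => f x + g x) N = psum D f N + psum D g N.
Proof.
rewrite -big_split; apply: eq_bigr => n _; rewrite /cterm.
by case: pickle_inv => [x|]; [case: asboolP|]; rewrite //= addr0.
Qed.

Lemma psumD1 f x N : D x -> (pickle x < N)%N ->
  psum D f N = f x + psum (D `\ x) f N.
Proof.
move=> Dx xN; rewrite /psum !big_mkord.
rewrite (bigD1 (Ordinal xN))//= cterm_pickle// [in RHS](bigD1 (Ordinal xN))//=.
rewrite [cterm (D `\ x) f _]/cterm pickleK_inv.
rewrite asboolF; last by case=> _; apply.
rewrite add0r; congr (_ + _).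
apply: eq_bigr => n nx; rewrite /cterm.
case e : (pickle_inv n) => [y|//].
have yx : y <> x.
  move=> yx; move: nx; rewrite -val_eqE /= -yx.
  by have := @pickle_invK T n; rewrite /ocancel e /= => ->; rewrite eqxx.
suff -> : `[< (D `\ x) y >] = `[< D y >] by [].
by apply: asbool_equiv_eq; split=> [[]|].
Qed.

End PsumAlgebra.

Section PsumReal.
Variables (R : realType) (T : countType) (D : set T).
Implicit Types (f g : T -> R) (N : nat).

Lemma psumZ (a : R) f N : psum D (fun x => a * f x) N = a * psum D f N.
Proof.
rewrite mulr_sumr; apply: eq_bigr => n _; rewrite /cterm.
by case: pickle_inv => [x|]; [case: asboolP|]; rewrite // mulr0.
Qed.

Lemma le_psum f g N : (forall x, D x -> f x <= g x) -> psum D f N <= psum D g N.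
Proof.
move=> fg; apply: ler_sum => n _; rewrite /cterm.
by case: pickle_inv => // x; case: asboolP => // /fg.
Qed.

Lemma ler_norm_psum f N : `|psum D f N| <= psum D (fun x => `|f x|) N.
Proof.
apply: le_trans (ler_norm_sum _ _ _) _; apply: ler_sum => n _; rewrite /cterm.
by case: pickle_inv => [x|]; [case: asboolP|]; rewrite // normr0.
Qed.

(** Codes outside the image of D carry the value 0, so summing over D or over all codes is the
    same. *)
Lemma esum_cterm (f : T -> \bar R) : (forall x, D x -> 0 <= f x)%E ->
  (\esum_(x in D) f x = \sum_(n <oo) cterm D f n)%E.
Proof.
move=> f0.
have c0 n : (0 <= cterm D f n)%E.
  by rewrite /cterm; case: pickle_inv => // x; case: asboolP => // /f0.
rewrite nneseries_esumT//.
transitivity (\esum_(n in pickle @` D) cterm D f n)%E.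
  rewrite (@reindex_esum _ _ _ D _ (@pickle T))//.
    by apply: eq_esum => x Dx; rewrite cterm_pickle.
  split=> [x Dx|x y _ _ e|]; [exact: imageP| |exact: subset_refl].
  by apply: Some_inj; rewrite -!pickleK_inv e.
rewrite esum_mkcond; apply: eq_esum => n _; case: ifPn => // /negP nD.
rewrite /cterm; case e : pickle_inv => [x|//]; case: asboolP => // Dx.
case: nD; rewrite inE; exists x => //.
by have := @pickle_invK T n; rewrite /ocancel e.
Qed.

Lemma ge0_esumZl (c : R) (f : T -> \bar R) : (forall x, D x -> 0 <= f x)%E ->
  0 <= c -> (\esum_(x in D) (c%:E * f x) = c%:E * \esum_(x in D) f x)%E.
Proof.
move=> f0 c0; rewrite !esum_cterm//; last by move=> x Dx; rewrite mule_ge0// f0.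
have cf0 n : (0 <= cterm D f n)%E.
  by rewrite /cterm; case: pickle_inv => // x; case: asboolP => // /f0.
rewrite -nneseriesZl//; apply: eq_eseriesr => n _; rewrite /cterm.
by case: pickle_inv => [x|]; [case: asboolP|]; rewrite // mule0.
Qed.

Lemma psum_EFin f N : (psum D f N)%:E = psum D (EFin \o f) N.
Proof.
rewrite -sumEFin; apply: eq_bigr => n _; rewrite /cterm.
by case: pickle_inv => // x; case: asboolP.
Qed.

Lemma psum_cvgE f : (forall x, D x -> 0 <= f x) ->
  (psum D f N)%:E @[N --> \oo] --> (\esum_(x in D) (f x)%:E)%E.
Proof.
move=> f0; rewrite esum_cterm//; under eq_fun do rewrite psum_EFin.
apply: is_cvg_nneseries => n _ _.
by rewrite /cterm; case: pickle_inv => // x; case: asboolP => // /f0.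
Qed.

Lemma psum_cvg f : (forall x, D x -> 0 <= f x) ->
  (\esum_(x in D) (f x)%:E < +oo)%E ->
  psum D f @ \oo --> fine (\esum_(x in D) (f x)%:E)%E.
Proof.
move=> f0 foo; apply: (fine_cvg (f := fun N => (psum D f N)%:E)).
by rewrite fineK ?ge0_fin_numE ?esum_ge0//; exact: psum_cvgE.
Qed.

Lemma psum_le_fine f N : (forall x, D x -> 0 <= f x) ->
  (\esum_(x in D) (f x)%:E < +oo)%E ->
  psum D f N <= fine (\esum_(x in D) (f x)%:E)%E.
Proof.
move=> f0 foo; rewrite -(cvg_lim _ (psum_cvg f0 foo))//.
apply: nondecreasing_cvgn_le; last by apply/cvg_ex; eexists; exact: psum_cvg.
apply/nondecreasing_seqP => n; rewrite /psum big_nat_recr//= lerDl.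
by rewrite /cterm; case: pickle_inv => // x; case: asboolP => // /f0.
Qed.

Lemma usum_cvg f : (\esum_(x in D) `|f x|%:E < +oo)%E ->
  psum D f @ \oo --> usum D f.
Proof.
move=> foo.
have pos x : 0 <= f^\+ x by [].
have neg x : 0 <= f^\- x by [].
have lt1 : (\esum_(x in D) (f^\+ x)%:E < +oo)%E.
  apply: le_lt_trans foo; apply: le_esum => x _.
  by rewrite lee_fin /funrpos ge_max ler_norm normr_ge0.
have lt2 : (\esum_(x in D) (f^\- x)%:E < +oo)%E.
  apply: le_lt_trans foo; apply: le_esum => x _.
  by rewrite lee_fin /funrneg ge_max -normrN ler_norm normr_ge0.
have -> : psum D f = (fun N => psum D f^\+ N + (-1) * psum D f^\- N).
  apply/funext => N; rewrite -psumZ -psumD; apply: eq_psum => x _.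
  by rewrite mulN1r -[in LHS](funrposBneg f).
rewrite /usum -[X in _ - X]mul1r -mulNr.
apply: cvgD; first exact: psum_cvg.
by apply: cvgMl_tmp; exact: psum_cvg.
Qed.

End PsumReal.

(** * Integration against a countable sum of measures *)

Section IntegralEsum.
Local Open Scope ereal_scope.
Context d (X : measurableType d) (R : realType) (I : countType).
Variables (D : set I) (m : I -> {measure set X -> \bar R}).
Variable mu : {measure set X -> \bar R}.
Hypothesis mu_esum : forall A, measurable A -> mu A = \esum_(i in D) m i A.

Let mseq (n : nat) : {measure set X -> \bar R} :=
  if pickle_inv n is Some i then (if `[< D i >] then m i else mzero)
  else mzero.

Lemma ge0_integral_esum (E : set X) (f : X -> \bar R) : measurable E ->
  (forall x, E x -> 0 <= f x) -> measurable_fun E f ->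
  \int[mu]_(x in E) f x = \esum_(i in D) \int[m i]_(x in E) f x.
Proof.
move=> mE f0 mf.
rewrite (@eq_measure_integral _ _ _ _ (mseries mseq 0)); last first.
  move=> A mA _; rewrite mu_esum// esum_cterm//.
  apply: eq_eseriesr => n _; rewrite /mseq /cterm.
  by case: pickle_inv => // i; case: asboolP.
rewrite ge0_integral_measure_series// esum_cterm; last first.
  by move=> i _; exact: integral_ge0.
apply: eq_eseriesr => n _; rewrite /mseq /cterm.
case: pickle_inv => [i|]; last by rewrite integral_measure_zero.
by case: asboolP => // _; rewrite integral_measure_zero.
Qed.

End IntegralEsum.

Lemma esum_finType (R : realType) (T : finType) (P : set T) (f : T -> R) :
  (forall t, P t -> 0 <= f t) ->
  (\esum_(t in P) (f t)%:E = (\sum_(t | `[< P t >]) f t)%:E)%E.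
Proof.
move=> f0; rewrite esum_fset; last first.
- by move=> t Pt; rewrite lee_fin f0// -in_setE.
- exact: finite_finset.
rewrite fsumEFin; last exact: finite_finset.
congr EFin; rewrite [RHS]bigfs ?index_enum_uniq//; last first.
  by move=> t _; rewrite mem_index_enum.
by rewrite [X in \sum_(t \in X) _ = _](_ : P = [set` fun t => `[< P t >]])//;
  apply/seteqP; split=> t /=; rewrite /in_mem /= asboolE.
Qed.

(** * Finiteness of the masses *)

Section Count.
Variables (b : nat) (w : word b).
Hypothesis w_gt0 : (0 < size w)%N.

Definition nfree n := #|[pred t : n.-tuple 'I_b | occ w t == 0%N]|.

Lemma nfree_le n : (nfree n <= b ^ n)%N.
Proof. by rewrite -(card_ord b) -card_tuple max_card. Qed.

(** Cut a w-free word after |w| letters: the first block is any word of that length but w, and the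
    rest is again w-free. *)
Lemma nfreeD m : (nfree (size w + m) <= (b ^ size w).-1 * nfree m)%N.
Proof.
pose f (p : (size w).-tuple 'I_b * m.-tuple 'I_b) := cat_tuple p.1 p.2.
pose A := [predX predC1 (in_tuple w) & [pred t : m.-tuple 'I_b | occ w t == 0%N]].
have -> : ((b ^ size w).-1 * nfree m)%N = #|A|.
  by rewrite cardX cardC1 card_tuple card_ord.
apply: leq_trans (leq_image_card f A); apply: subset_leq_card.
apply/fintype.subsetP => t /=; rewrite inE => /eqP t0.
have s1 : size (take (size w) t) == size w.
  by rewrite size_takel// size_tuple leq_addr.
have s2 : size (drop (size w) t) == m by rewrite size_drop size_tuple addKn.
apply/fintype.imageP; exists (Tuple s1, Tuple s2); last first.
  by apply: val_inj; rewrite /= cat_take_drop.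
rewrite inE /= inE; apply/andP; split.
  apply/eqP => /(congr1 val) /= e; move: t0.
  by rewrite -(cat_take_drop (size w) t) e occ_self.
by rewrite inE -leqn0 -[leqRHS]t0 -{2}(cat_take_drop (size w) t) occ_catr.
Qed.

Variable R : realType.
Hypothesis b_gt1 : (1 < b)%N.

Let c n : R := (nfree n)%:R / b%:R ^+ n.

Let bp0 n : 0 < b%:R ^+ n :> R.
Proof. by rewrite exprn_gt0// ltr0n ltnW. Qed.

(* Cutting off the first |w| letters gives S <= |w| + (1 - b^-|w|) S. *)
Lemma sum_nfree_le M :
  \sum_(n < M) (nfree n)%:R / b%:R ^+ n <= (size w)%:R * b%:R ^+ size w :> R.
Proof.
have c0 n : 0 <= c n by rewrite divr_ge0// ltW.
have c1 n : c n <= 1.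
  by rewrite ler_pdivrMr// mul1r -natrX ler_nat nfree_le.
have cD n : c (size w + n)%N <= (1 - b%:R ^- size w) * c n.
  rewrite {1}/c ler_pdivrMr//.
  suff -> : (1 - b%:R ^- size w) * c n * b%:R ^+ (size w + n)%N =
      ((b ^ size w).-1 * nfree n)%:R by rewrite ler_nat nfreeD.
  rewrite /c exprD -subn1 natrM natrB ?expn_gt0 ?(ltnW b_gt1)// natrX.
  by field; rewrite !gt_eqF.
set S := \sum_(n < M) _.
have S1 : S <= (size w)%:R + (1 - b%:R ^- size w) * S.
  (* The range is lengthened by |w| so that removing the first |w| terms, each at most 1, leaves a
     shifted sum of exactly M terms. *)
  apply: (@le_trans _ _ (\sum_(n < size w + M) c n)).
    rewrite addnC big_split_ord /= lerDl; exact: sumr_ge0.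
  rewrite big_split_ord /=; apply: lerD.
    rewrite -[X in X%:R]card_ord -sumr_const; exact: ler_sum.
  by rewrite mulr_sumr; apply: ler_sum => i _; exact: cD.
have : S * b%:R ^- size w <= (size w)%:R by lra.
by rewrite ler_pdivrMr.
Qed.

Lemma langF_mass : (\esum_(g in langF w) (b%:R ^- size g : R)%:E < +oo)%E.
Proof.
pose L n := [set g | langF w g /\ size g = n].
have -> : langF w = \bigcup_(n in setT) L n.
  by apply/seteqP; split=> [g Fg|g [n _ []]//]; exists (size g).
rewrite esum_bigcupT; last first.
- by move=> g; rewrite lee_fin invr_ge0 ltW.
- by move=> i j _ _ [g [[_ <-] [_ <-]]].
rewrite (eq_esum (b := fun n => (c n)%:E)); last first.
  move=> n _.
  rewrite (@reindex_esum _ _ _ [set t : n.-tuple 'I_b | occ w t = 0%N] _ val).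
    rewrite esum_finType; last by move=> t _; rewrite invr_ge0 ltW.
    congr EFin; under eq_bigr do rewrite size_tuple.
    rewrite sumr_const /c -[LHS]mulr_natl; congr (_%:R * _).
    by apply: eq_card => t; rewrite !inE; apply/asboolP/eqP.
  split=> [t /= t0|t u _ _|g [F0 /eqP sg]]; last by exists (Tuple sg).
  - by split; rewrite ?size_tuple.
  - exact: val_inj.
rewrite -nneseries_esumT; last by move=> n; rewrite lee_fin divr_ge0// ltW.
apply: (@le_lt_trans _ _ ((size w)%:R * b%:R ^+ size w)%:E); last exact: ltry.
apply: lime_le.
  by apply: is_cvg_nneseries => n _ _; rewrite lee_fin divr_ge0// ltW.
apply: nearW => M; rewrite big_mkord sumEFin lee_fin; exact: sum_nfree_le.
Qed.

Lemma langR_mass : (\esum_(g in langR w) (b%:R ^- size g : R)%:E < +oo)%E.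
Proof.
apply: le_lt_trans langF_mass; rewrite esum_mkcond [leRHS]esum_mkcond.
apply: le_esum => g _; case: ifPn => gR.
  by rewrite ifT// inE; apply: langR_langF => //; rewrite inE in gR.
by case: ifPn => // _; rewrite lee_fin invr_ge0 ltW.
Qed.

Lemma langG_last g x : langG w g -> last x g = last x w.
Proof.
move=> G; have g0 := langG_size_gt0 w_gt0 G; case: G => _ /suffixP[s].
move=> /(congr1 (last x)); rewrite !last_cat.
by case: g g0 => // y g _; case: w w_gt0.
Qed.

(** All words of G end with the last letter of w, so deleting that letter is injective on G. It
    destroys the terminal occurrence and lands in R, whose mass is finite. *)
Lemma langG_mass : (\esum_(g in langG w) (b%:R ^- size g : R)%:E < +oo)%E.
Proof.
pose a (h : word b) : \bar R := (b%:R ^- (size h).+1)%:E.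
have a0 (h : word b) : (0 <= a h)%E by rewrite lee_fin invr_ge0 ltW.
have bE (x : 'I_b) (g : word b) : langG w g -> g = rcons (belast (head x g) (behead g)) (last x w).
  by move=> G; have := langG_size_gt0 w_gt0 G; rewrite -(langG_last x G);
    case: g {G} => //= y g _; rewrite -lastI.
have [x _] : exists x : 'I_b, True by exists (Ordinal (ltnW b_gt1)).
(* On a nonempty g this deletes the last letter; [x] is only a default value for [head]. *)
pose f (g : word b) := belast (head x g) (behead g).
apply: (@le_lt_trans _ _ (\esum_(h in f @` langG w) a h)%E).
  rewrite [leRHS](@reindex_esum _ _ _ (langG w) _ f).
    apply: le_esum => g /(bE x) {1}->; rewrite size_rcons; exact: lexx.
  split; [by move=> g Gg; exact: imageP| |by move=> h].
  by move=> g h; rewrite !inE => /(bE x) eg /(bE x) eh fgh; rewrite eg eh -!/(f _) fgh.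
apply: le_lt_trans langR_mass; rewrite esum_mkcond [leRHS]esum_mkcond.
apply: le_esum => h _; case: ifPn => [|_]; last first.
  by case: ifPn => // _; rewrite lee_fin invr_ge0 ltW.
rewrite inE => -[g G <-]; rewrite ifT; last first.
  by rewrite inE; apply: (langG_rcons w_gt0 (x := last x w)); rewrite -bE.
rewrite lee_fin lef_pV2 ?posrE//; rewrite ler_eXn2l// ?ltr1n//.
Qed.

End Count.

(** * Integrals *)

Lemma poly_bounded (R : realType) (p : {poly R}) (r : R) :
  exists M, forall x, `|x| <= r -> `|p.[x]| <= M.
Proof.
exists (\sum_(i < size p) `|p`_i| * r ^+ i) => x xr.
rewrite horner_coef; apply: le_trans (ler_norm_sum _ _ _) _.
apply: ler_sum => i _; rewrite normrM normrX ler_wpM2l//.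
by rewrite lerXn2r ?nnegrE// (le_trans _ xr).
Qed.

Lemma measurable_horner (R : realType) (p : {poly R}) (D : set (measurableTypeR R)) :
  measurable_fun D (horner p : measurableTypeR R -> measurableTypeR R).
Proof.
apply: (measurable_funS measurableT) => //.
by apply: continuous_measurable_fun; exact: continuous_horner.
Qed.

Section BoundedIntegral.
Variables (R : realType) (mu : {measure set (measurableTypeR R) -> \bar R}).
Variable D : set (measurableTypeR R).
Hypotheses (mD : measurable D) (muD : (mu D < +oo)%E).
Implicit Types (f : measurableTypeR R -> measurableTypeR R) (p q : {poly R}).

Lemma bounded_integrable f M : measurable_fun D f ->
  (forall x, D x -> `|f x| <= M) -> mu.-integrable D (EFin \o f).
Proof.
move=> mf fM; apply: measurable_bounded_integrable => //.
exists M; split; first exact: num_real.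
by move=> y My x /= Dx; rewrite (le_trans (fM x Dx))// ltW.
Qed.

Lemma ler_norm_Rintegral f M : measurable_fun D f ->
  (forall x, D x -> `|f x| <= M) ->
  `|\int[mu]_(x in D) f x| <= M * fine (mu D).
Proof.
move=> mf fM; have fi := bounded_integrable mf fM.
apply: le_trans (le_normr_Rintegral mD fi) _.
rewrite -Rintegral_cst//; apply: le_Rintegral => //.
- by have := integrable_norm fi.
- by apply: bounded_integrable => // x _; exact: lexx.
Qed.

Hypothesis D01 : D `<=` `[0, 1]%classic.

Lemma horner_integrable p : mu.-integrable D (EFin \o horner p).
Proof.
have [M pM] := poly_bounded p 1; apply: (bounded_integrable (M := M)).
  exact: measurable_horner.
by move=> x /D01 /=; rewrite in_itv /= => /andP[x0 x1]; apply: pM; rewrite ger0_norm.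
Qed.

Definition poly_integral p : R := \int[mu]_(x in D) p.[x].

Lemma poly_integral_linear a p q : poly_integral (a *: p + q) = a * poly_integral p + poly_integral q.
Proof.
have i := horner_integrable.
have ia : mu.-integrable D (EFin \o (fun x => a * p.[x])).
  by rewrite (_ : _ \o _ = EFin \o horner (a *: p))//;
    apply/funext => x /=; rewrite hornerZ.
rewrite /poly_integral -RintegralZl// -RintegralD//.
by apply: eq_Rintegral => x _; rewrite hornerD hornerZ.
Qed.

Lemma poly_integralD : {morph poly_integral : p q / p + q}.
Proof. by move=> p q; rewrite -[p]scale1r poly_integral_linear mul1r scale1r. Qed.

Lemma poly_integral0 : poly_integral 0 = 0.
Proof. by have := poly_integral_linear (-1) 0 0; rewrite scaler0 addr0 mulN1r addNr. Qed.

Lemma poly_integral_sum (I : Type) (r : seq I) (P : pred I) (F : I -> {poly R}) :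
  poly_integral (\sum_(i <- r | P i) F i) = \sum_(i <- r | P i) poly_integral (F i).
Proof. exact: (big_morph _ poly_integralD poly_integral0). Qed.

Lemma poly_integralZ a p : poly_integral (a *: p) = a * poly_integral p.
Proof. by rewrite -[a *: p]addr0 poly_integral_linear poly_integral0 addr0. Qed.

Lemma poly_integralB p q : poly_integral (p - q) = poly_integral p - poly_integral q.
Proof. by rewrite addrC -scaleN1r poly_integral_linear mulN1r addrC. Qed.

Lemma poly_integral_coef n p : (size p <= n)%N ->
  poly_integral p = \sum_(i < n) p`_i * poly_integral 'X^i.
Proof.
move=> pn; rewrite {1}(_ : p = \sum_(i < n) p`_i *: 'X^i).
  by rewrite poly_integral_sum; apply: eq_bigr => i _; rewrite poly_integralZ.
rewrite -poly_def; apply/polyP => i; rewrite coef_poly.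
by case: ltnP => // /(leq_trans pn)/(nth_default 0).
Qed.

Lemma ler_norm_poly_integral p M : (forall x, D x -> `|p.[x]| <= M) ->
  `|poly_integral p| <= M * fine (mu D).
Proof. by move=> pM; apply: ler_norm_Rintegral => //; exact: measurable_horner. Qed.

End BoundedIntegral.

Section Atomic.
Variables (R : realType) (b : nat) (L : set (word b)).
Variable E : set (measurableTypeR R).
Hypotheses (mE : measurable E) (xE : forall g : word b, E (xval R g)).

Lemma integral_atomic (f : R -> R) :
  measurable_fun E (f : measurableTypeR R -> measurableTypeR R) ->
  (forall x, E x -> 0 <= f x) ->
  (\int[atomic L]_(x in E) (f x)%:E =
   \esum_(g in L) (b%:R ^- size g * f (xval R g))%:E)%E.
Proof.
move=> mf f0.
have b0 (g : word b) : 0 <= b%:R ^- size g :> R by rewrite invr_ge0 exprn_ge0.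
pose m (g : word b) : {measure set (measurableTypeR R) -> \bar R} :=
  mscale (NngNum (b0 g)) (\d_(xval R g : measurableTypeR R)).
have mef : measurable_fun E (EFin \o f) by exact/measurable_EFinP.
rewrite (@ge0_integral_esum _ _ R _ L m)//.
apply: eq_esum => g _; rewrite ge0_integral_mscale// integral_dirac//=.
by rewrite diracE mem_set// mul1e EFinM.
Qed.

End Atomic.

(** * Invariance of nu_j in integral form *)

Section Nu.
Variables (R : realType) (b : nat) (w : word b) (j : nat).
Variable nu : probability (measurableTypeR R) R.
Hypotheses (w_gt0 : (0 < size w)%N) (b_gt1 : (1 < b)%N).
Hypothesis nuP : is_nu w j nu.
Local Notation I01 := (`[0%R, 1%R]%classic : set (measurableTypeR R)).

Lemma xval_ge0 (g : word b) : 0 <= xval R g.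
Proof. by rewrite divr_ge0// exprn_ge0. Qed.

Lemma xval_le (g : word b) : xval R g + b%:R ^- size g <= 1.
Proof.
rewrite /xval -[X in _ + X]mul1r -mulrDl.
rewrite ler_pdivrMr ?exprn_gt0 ?ltr0n ?(ltnW b_gt1)// mul1r.
by rewrite -natrX natr1 ler_nat; exact: nval_lt.
Qed.

Lemma phi_01 (g : word b) (x : R) : 0 <= x <= 1 -> 0 <= phi g x <= 1.
Proof.
move=> /andP[x0 x1]; have i0 : 0 <= b%:R ^- size g :> R by rewrite invr_ge0 exprn_ge0.
rewrite /phi addr_ge0 ?xval_ge0 ?mulr_ge0//=.
by rewrite (le_trans _ (xval_le g))// lerD2l ler_piMr.
Qed.

Lemma lambda_ge0 : 0 <= lambda R w j.
Proof.
by apply: fine_ge0; apply: esum_ge0 => g _; rewrite lee_fin invr_ge0 exprn_ge0.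
Qed.

(** [is_nu] equates two measures: the weighted sum of the pushforwards, and a multiple of nu. The
    function f is integrated against both. *)
Lemma integral_nu (f : R -> R) :
  measurable_fun setT (f : measurableTypeR R -> measurableTypeR R) ->
  (forall x, 0 <= x <= 1 -> 0 <= f x) ->
  (\esum_(g in langG w) ((b%:R ^- (j * size g))%:E *
      \int[nu]_(x in I01) (f (phi g x))%:E) =
   (lambda R w j)%:E * \int[nu]_(x in I01) (f x)%:E)%E.
Proof.
move=> mf f0.
have f0' x : I01 x -> (0 <= (f x)%:E)%E.
  by rewrite /= in_itv /= => h; rewrite lee_fin f0.
have b0 (g : word b) : 0 <= b%:R ^- (j * size g) :> R by rewrite invr_ge0 exprn_ge0.
have mphi (g : word b) : measurable_fun setT
    (phi g : measurableTypeR R -> measurableTypeR R).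
  rewrite (_ : phi g = horner ((b%:R ^- size g) *: 'X + (xval R g)%:P)).
    exact: measurable_horner.
  by apply/funext => x; rewrite !hornerE /phi addrC.
have mI : measurable I01 by exact: measurable_itv.
pose m (g : word b) : {measure set (measurableTypeR R) -> \bar R} :=
  mscale (NngNum (b0 g)) (measure_function_pushforward__canonical__measure_function_Measure nu (mphi g)).
have me : measurable_fun setT (EFin \o f) by exact/measurable_EFinP.
have meI : measurable_fun I01 (EFin \o f) by exact: measurable_funS me.
transitivity (\int[mscale (NngNum lambda_ge0) nu]_(x in I01) (f x)%:E)%E; last first.
  by rewrite ge0_integral_mscale.
rewrite (@ge0_integral_esum _ _ R _ (langG w) m)//; last first.
  by move=> A mA; exact/esym/(nuP.2 A mA).
apply: eq_esum => g _; rewrite ge0_integral_mscale//=; congr (_ * _)%E.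
rewrite ge0_integral_pushforward//; last by move=> x; rewrite inE; exact: f0'.
have mp : measurable (phi g @^-1` I01 : set (measurableTypeR R)).
  by rewrite -[X in measurable X]setTI; apply: (mphi g).
(* The change of variables produces the preimage of [0,1] under phi_g. It contains [0,1], and what
   lies outside [0,1] is nu-null. *)
have e : I01 = (phi g @^-1` I01 : set (measurableTypeR R)) `\` ~` I01.
  apply/seteqP; split=> [x Ix|x [_]]; last by rewrite /= notK.
  by split; [move: Ix; rewrite /= !in_itv; exact: phi_01|move=> h; exact: h].
rewrite [in LHS]e -ge0_negligible_integral//.
- exact: measurableC.
- apply: (measurable_funS measurableT) => //.
  exact: (measurableT_comp me (mphi g)).
- by move=> x; exact: f0'.
- by apply: etrans (probability_setC nu mI) _; rewrite nuP.1 subee.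
Qed.

End Nu.

(** * Polynomials *)

Section PolyTools.
Variable R : realType.
Implicit Types p q : {poly R}.

Definition affine (a c : R) : {poly R} := a *: 'X + c%:P.

Lemma horner_comp_affine p a c x : (p \Po affine a c).[x] = p.[a * x + c].
Proof. by rewrite horner_comp !hornerE. Qed.

Lemma derivn_comp_affine p a c k :
  (p \Po affine a c)^`(k) = a ^+ k *: (p^`(k) \Po affine a c).
Proof.
elim: k => [|k IH]; first by rewrite !derivn0 scale1r.
rewrite !derivnS IH derivZ deriv_comp /affine derivD derivC derivZ derivX addr0.
by rewrite -scalerAr mulr1 scalerA exprSr.
Qed.

Lemma derivn_nderivn p k : p^`(k) = (k`!)%:R *: p^`N(k).
Proof. by rewrite nderivn_def scaler_nat. Qed.

Lemma nderivn_derivn p k : p^`N(k) = (k`!)%:R^-1 *: p^`(k).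
Proof.
by rewrite derivn_nderivn scalerA mulVf ?scale1r// pnatr_eq0 -lt0n fact_gt0.
Qed.

Lemma nderivn_comp_affine p a c k :
  (p \Po affine a c)^`N(k) = a ^+ k *: (p^`N(k) \Po affine a c).
Proof.
by rewrite !nderivn_derivn derivn_comp_affine comp_polyZ !scalerA mulrC.
Qed.

(** Inverting the Vandermonde matrix of the nodes j/d recovers the coefficients from finitely many
    values on [0,1]. In bounded degree, pointwise convergence on [0,1] thus becomes convergence of
    coefficients, derivatives and integrals. *)
Lemma coef_interpolation d : exists (x : 'I_d -> R) (a : 'I_d -> nat -> R),
  (forall j, 0 <= x j <= 1) /\
  forall p, (size p <= d)%N -> forall i, p`_i = \sum_(j < d) a j i * p.[x j].
Proof.
pose x (j : 'I_d) : R := j%:R / d%:R.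
pose V := Vandermonde d (\row_j x j).
have Vu : V \in unitmx.
  rewrite unitmxE unitfE det_Vandermonde; apply/prodf_neq0 => i _.
  apply/prodf_neq0 => j ij; rewrite !mxE -mulrBl mulf_neq0//.
    by rewrite subr_eq0 eqr_nat neq_ltn ij orbT.
  by rewrite invr_eq0 pnatr_eq0 -lt0n (leq_ltn_trans _ (ltn_ord i)).
(* Indices i >= d get weight 0, in accordance with the vanishing coefficients there. *)
exists x, (fun j i => if insub i is Some i' then invmx V j i' else 0); split.
  move=> j; rewrite divr_ge0//= ler_pdivrMr ?mul1r ?ler_nat 1?ltnW//.
  by rewrite ltr0n (leq_ltn_trans _ (ltn_ord j)).
move=> p pd i; case: insubP => [i' id <-|]; last first.
  by rewrite -leqNgt => di; rewrite nth_default ?(leq_trans pd)// big1// => j _; rewrite mul0r.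
have e : (\row_(k < d) p`_k) *m V = \row_j p.[x j].
  apply/rowP => j; rewrite !mxE (horner_coef_wide _ pd).
  by apply: eq_bigr => k _; rewrite !mxE.
have := congr1 (fun r => (r *m invmx V) 0 i') e.
rewrite mulmxK// !mxE => ->; apply: eq_bigr => j _.
by rewrite !mxE mulrC.
Qed.

Lemma cvg_bigsum (I : Type) (r : seq I) (F : I -> nat -> R) (l : I -> R) :
  (forall i, F i n @[n --> \oo] --> l i) ->
  \sum_(i <- r) F i n @[n --> \oo] --> \sum_(i <- r) l i.
Proof.
move=> Fl; elim: r => [|i r IH].
  by rewrite big_nil; under eq_fun do rewrite big_nil; exact: cvg_cst.
by rewrite big_cons; under eq_fun do rewrite big_cons; exact: cvgD.
Qed.

Section Cvg.
Variables (P_ : nat -> {poly R}) (p : {poly R}) (d : nat).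
Hypothesis Pd : forall n, (size (P_ n) <= d)%N.
Hypothesis pd : (size p <= d)%N.
Hypothesis Pp : forall x, 0 <= x <= 1 -> (P_ n).[x] @[n --> \oo] --> p.[x].

Lemma coef_cvg i : (P_ n)`_i @[n --> \oo] --> p`_i.
Proof.
have [x [a [x01 E]]] := coef_interpolation d.
rewrite E//; under eq_fun do rewrite E//.
by apply: cvg_bigsum => j; apply: cvgMl_tmp; exact: Pp.
Qed.

Lemma nderivn_coef_cvg k i : (P_ n)^`N(k)`_i @[n --> \oo] --> p^`N(k)`_i.
Proof.
have E q : q^`N(k)`_i = 'C(k + i, k)%:R * q`_(k + i).
  by rewrite coef_nderivn [RHS]mulr_natl.
rewrite E; under eq_fun do rewrite E.
by apply: cvgMl_tmp; exact: coef_cvg.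
Qed.

Let size_nderivn q k : (size q <= d)%N -> (size q^`N(k) <= d)%N.
Proof.
by move=> qd; rewrite /nderivn (leq_trans (size_poly _ _))// (leq_trans (leq_subr _ _)).
Qed.

Lemma nderivn_horner_cvg k x : (P_ n)^`N(k).[x] @[n --> \oo] --> p^`N(k).[x].
Proof.
rewrite (horner_coef_wide _ (size_nderivn k pd)).
under eq_fun do rewrite (horner_coef_wide _ (size_nderivn k (Pd _))).
by apply: cvg_bigsum => i; apply: cvgMr_tmp; exact: nderivn_coef_cvg.
Qed.

Lemma nderivn_poly_integral_cvg (mu : {measure set (measurableTypeR R) -> \bar R})
    (D : set (measurableTypeR R)) k :
    measurable D -> (mu D < +oo)%E -> D `<=` `[0, 1]%classic ->
  poly_integral mu D (P_ n)^`N(k) @[n --> \oo] --> poly_integral mu D p^`N(k).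
Proof.
move=> mD muD D01.
rewrite (poly_integral_coef mD muD D01 (size_nderivn k pd)).
under eq_fun do rewrite (poly_integral_coef mD muD D01 (size_nderivn k (Pd _))).
by apply: cvg_bigsum => i; apply: cvgMr_tmp; exact: nderivn_coef_cvg.
Qed.

End Cvg.

Lemma horner_lipschitz p (I : interval R) M :
  (forall x, x \in I -> `|p^`().[x]| <= M) ->
  forall x y, x \in I -> y \in I -> `|p.[x] - p.[y]| <= M * `|x - y|.
Proof.
move=> pM x y xI yI; wlog xy : x y xI yI / y <= x.
  move=> W; have [/W->//|/ltW xy] := leP y x.
  by rewrite distrC [in leRHS]distrC W.
have [|c cI ->] := @MVT_segment R (horner p) (fun x => p^`().[x]) y x xy _.
  by apply: continuous_subspaceT; exact: continuous_horner.
rewrite normrM ler_wpM2r// pM//.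
by move: cI; rewrite in_itv /= => /(interval_is_interval yI xI).
Qed.

End PolyTools.

(** * The eigenvalue equations *)

Section Transfer.
Variables (R : realType) (b : nat) (w : word b).
Hypotheses (w_gt0 : (0 < size w)%N) (b_gt1 : (1 < b)%N).
Local Notation I01 := (`[0%R, 1%R]%classic : set (measurableTypeR R)).
Local Notation G := (langG w).
Local Notation q := (b%:R^-1 : R).
Local Notation lam := (lambda R w).

Let b_gt0 : 0 < b%:R :> R. Proof. by rewrite ltr0n ltnW. Qed.

Lemma bpow_gt0 n : 0 < b%:R ^- n :> R.
Proof. by rewrite invr_gt0 exprn_gt0. Qed.
Local Hint Resolve bpow_gt0 : core.

Lemma bpow_ge0 n : 0 <= b%:R ^- n :> R. Proof. exact: ltW. Qed.
Local Hint Resolve bpow_ge0 : core.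

Lemma bpow_le m n : (m <= n)%N -> b%:R ^- n <= b%:R ^- m :> R.
Proof.
by move=> mn; rewrite lef_pV2 ?posrE ?exprn_gt0// ler_weXn2l// ler1n ltnW.
Qed.

Lemma bpowD m n : b%:R ^- (m + n) = b%:R ^- m * b%:R ^- n :> R.
Proof. by rewrite exprD invfM. Qed.

Lemma bpow_langG_fin j : (0 < j)%N ->
  (\esum_(g in G) (b%:R ^- (j * size g) : R)%:E < +oo)%E.
Proof.
move=> j0; apply: le_lt_trans (langG_mass w_gt0 R b_gt1).
by apply: le_esum => g _; rewrite lee_fin bpow_le// leq_pmull.
Qed.

Lemma lambda_cvg j : (0 < j)%N ->
  psum G (fun g => b%:R ^- (j * size g)) @ \oo --> lam j.
Proof. by move=> j0; apply: psum_cvg => //; exact: bpow_langG_fin. Qed.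

Lemma lambda_ge j g : (0 < j)%N -> G g -> b%:R ^- (j * size g) <= lam j.
Proof.
move=> j0 Gg; apply: le_trans (psum_le_fine (pickle g).+1 _ (bpow_langG_fin j0)) => //.
rewrite (psumD1 _ Gg)//= lerDl.
by apply: sumr_ge0 => n _; rewrite /cterm; case: pickle_inv => // x; case: asboolP.
Qed.

Lemma lambda_gt0 j : (0 < j)%N -> 0 < lam j.
Proof.
move=> j0; have [g Gg _] := langG_short w_gt0.
exact: lt_le_trans (lambda_ge j0 Gg).
Qed.

(** Words of G are nonempty, so every term loses at least a factor b. The eigenvalues are therefore
    strictly decreasing, which biorthogonality rests on. *)
Lemma lambdaS j : (0 < j)%N -> lam j.+1 <= q * lam j.
Proof.
move=> j0.
have c2 : q * psum G (fun g => b%:R ^- (j * size g)) N @[N --> \oo] --> q * lam j.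
  by apply: cvgMl_tmp; exact: lambda_cvg.
apply: (ler_cvg_to (lambda_cvg (ltn0Sn j)) c2).
apply: nearW => N; rewrite -psumZ; apply: le_psum => g Gg.
by rewrite -exprVn mulSn addnC exprVn bpowD mulrC ler_wpM2r// -[X in _ <= X^-1]expr1
  bpow_le// (langG_size_gt0 w_gt0 Gg).
Qed.

Lemma lambda_lt i j : (0 < i)%N -> (i < j)%N -> lam j < lam i.
Proof.
move=> i0; elim: j => // j IH; rewrite ltnS leq_eqVlt => ij.
have j0 : (0 < j)%N by case/orP: ij => [/eqP <-//|]; exact: leq_trans.
have h : lam j.+1 < lam j.
  apply: le_lt_trans (lambdaS j0) _.
  by rewrite gtr_pMl ?lambda_gt0// invf_lt1// ltr1n.
by case/orP: ij => [/eqP ->//|/IH]; exact: lt_trans.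
Qed.

Section Measure.
Variables (j : nat) (nu : probability (measurableTypeR R) R).
Hypotheses (j_gt0 : (0 < j)%N) (nuP : is_nu w j nu).
Local Notation Enu := (poly_integral nu I01).

Lemma mI01 : measurable I01. Proof. exact: measurable_itv. Qed.

Local Notation nuM := (nu : {measure set (measurableTypeR R) -> \bar R}).

Let nu1 : nuM I01 = 1%E. Proof. exact: nuP.1. Qed.

Lemma nuI01_fin : (nuM I01 < +oo)%E.
Proof. by apply: le_lt_trans (ltry 1); rewrite -nu1. Qed.

Let fnu1 : fine (nuM I01) = 1. Proof. by have := congr1 fine nu1. Qed.

Let Esub : I01 `<=` `[0, 1]%classic. Proof. by []. Qed.

Lemma nu_poly_integral_le p M : (forall x, 0 <= x <= 1 -> `|p.[x]| <= M) ->
  `|Enu p| <= M.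
Proof.
move=> pM; have := ler_norm_poly_integral mI01 nuI01_fin (p := p) (M := M).
by rewrite [fine _]fnu1 mulr1; apply => x; rewrite /= in_itv; exact: pM.
Qed.

Lemma nu_poly_integral_C a : Enu a%:P = a.
Proof.
rewrite /poly_integral; under eq_Rintegral do rewrite hornerC.
by rewrite Rintegral_cst ?[fine _]fnu1 ?mulr1//; exact: mI01.
Qed.

Lemma EFin_poly_integral p : (\int[nu]_(x in I01) (p.[x])%:E = (Enu p)%:E)%E.
Proof.
rewrite /poly_integral /Rintegral fineK//; apply: integrable_fin_num; first exact: mI01.
exact: horner_integrable mI01 nuI01_fin Esub p.
Qed.

(** [integral_nu] asks for a nonnegative function on [0,1], so p is first raised by a bound M of its
    absolute value. The contribution of the constant M is M times the series of [lam j], and is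
    subtracted at the end. *)
Lemma nu_cvg p :
  psum G (fun g => b%:R ^- (j * size g) *
      Enu (p \Po affine (b%:R ^- size g) (xval R g))) @ \oo --> lam j * Enu p.
Proof.
have [M pM] := poly_bounded p 1.
pose r := p + M%:P.
have r0 x : 0 <= x <= 1 -> 0 <= r.[x].
  move=> /andP[x0 x1]; have := pM x; rewrite ger0_norm// => /(_ x1).
  by rewrite hornerD hornerC ler_norml => /andP[]; lra.
have ED u v : Enu (u + v) = Enu u + Enu v.
  exact: poly_integralD mI01 nuI01_fin Esub _ _.
have Er : psum G (fun g => b%:R ^- (j * size g) *
      Enu (r \Po affine (b%:R ^- size g) (xval R g))) @ \oo --> lam j * Enu r.
  have := integral_nu b_gt1 nuP (@measurable_horner R r setT) r0.
  rewrite EFin_poly_integral -EFinM => e.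
  have e' : (\esum_(g in G) (b%:R ^- (j * size g) *
      Enu (r \Po affine (b%:R ^- size g) (xval R g)))%:E = (lam j * Enu r)%:E)%E.
    rewrite -e; apply: eq_esum => g _; rewrite EFinM -EFin_poly_integral.
    congr (_ * _)%E; apply: eq_integral => x _.
    by rewrite horner_comp_affine /phi addrC.
  have := @psum_cvg R _ G (fun g => b%:R ^- (j * size g) *
      Enu (r \Po affine (b%:R ^- size g) (xval R g))).
  rewrite e'; apply; last exact: ltry.
  move=> g _; rewrite mulr_ge0//; apply: Rintegral_ge0 => x.
  rewrite /= in_itv /= => x01.
  by rewrite horner_comp_affine addrC; apply: r0; exact: (phi_01 b_gt1).
have -> : lam j * Enu p = lam j * Enu r + (- M) * lam j.
  by rewrite /r ED nu_poly_integral_C; ring.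
rewrite [X in X @ \oo --> _](_ : _ = fun N => psum G (fun g => b%:R ^- (j * size g) *
      Enu (r \Po affine (b%:R ^- size g) (xval R g))) N +
      (- M) * psum G (fun g => b%:R ^- (j * size g)) N); last first.
  apply/funext => N; rewrite -psumZ -psumD; apply: eq_psum => g _.
  by rewrite /r comp_polyD comp_polyC ED nu_poly_integral_C; ring.
by apply: cvgD => //; apply: cvgMl_tmp; exact: lambda_cvg.
Qed.

End Measure.

(** * The eigenvalue equation of B_m and its derivatives *)

Section Eigenpoly.
Variables (m : nat) (B : {poly R}).
Hypothesis BP : is_B w m B.

(** Partial sums of the operator K_w applied to B, kept as polynomials of degree at most m so that
    their limit may be differentiated and integrated term by term. *)
Let P_ N := psum G (fun g => b%:R ^- size g *:
   (B \Po affine (b%:R ^- size g) (xval R g))) N.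

Let sizeB : size B = m.+1. Proof. by case: BP. Qed.

Lemma size_comp_affine (p : {poly R}) a c : (size (p \Po affine a c) <= size p)%N.
Proof.
have [->|p0] := eqVneq p 0; first by rewrite comp_poly0.
apply: leq_trans (size_comp_poly_leq _ _) _.
have s2 : (size (affine a c) <= 2)%N.
  by rewrite /affine (leq_trans (size_polyD _ _))// geq_max (leq_trans (size_scale_leq _ _))
    ?size_polyX// (leq_trans (size_polyC_leq1 _)).
have := size_poly_gt0 p; rewrite p0.
by case: (size p) => // n _; case: (size (affine a c)) s2 => [|[|[|]]]//= _;
  rewrite ?muln0 ?muln1.
Qed.

Let P_size N : (size (P_ N) <= m.+1)%N.
Proof.
rewrite /P_ /psum; apply: (big_ind (fun p : {poly R} => (size p <= m.+1)%N)).
- by rewrite size_poly0.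
- by move=> p r ps rs; rewrite (leq_trans (size_polyD _ _))// geq_max ps.
move=> n _; rewrite /cterm; case: pickle_inv => [g|]; last by rewrite size_poly0.
case: asboolP => _; last by rewrite size_poly0.
by rewrite (leq_trans (size_scale_leq _ _))// -sizeB size_comp_affine.
Qed.

Let lB_size : (size (lam m.+1 *: B) <= m.+1)%N.
Proof. by rewrite (leq_trans (size_scale_leq _ _))// sizeB. Qed.

Let P_cvg x : 0 <= x <= 1 -> (P_ N).[x] @[N --> \oo] --> (lam m.+1 *: B).[x].
Proof.
move=> x01; rewrite hornerZ; case: BP => _ _ /(_ x x01) <-.
rewrite [X in X @ \oo --> _](_ : _ =
    psum G (fun g => b%:R ^- size g * B.[phi g x])).
  apply: usum_cvg; have [M BM] := poly_bounded B 1.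
  apply: (@le_lt_trans _ _ (\esum_(g in G) ((Num.max M 0)%:E * (b%:R ^- size g)%:E))%E).
    apply: le_esum => g _; rewrite -EFinM lee_fin normrM ger0_norm// mulrC.
    rewrite ler_wpM2r// le_max BM//.
    by have /andP[? ?] := phi_01 b_gt1 g x01; rewrite ger0_norm.
  rewrite ge0_esumZl ?le_max ?lexx ?orbT//.
  apply: lte_mul_pinfty; rewrite ?lee_fin ?le_max ?lexx ?orbT//.
  exact: langG_mass.
apply/funext => N; rewrite -[LHS]/(horner_eval x (P_ N)) psum_raddf.
apply: eq_psum => g _ /=.
by rewrite /horner_eval hornerZ horner_comp_affine /phi addrC.
Qed.

(** The chain rule contributes b^-(k|g|), which raises the weights to those defining lambda_(k+1)
    and nu_(k+1). *)
Lemma nderivn_psum k N : (P_ N)^`N(k) = psum G (fun g => b%:R ^- (k.+1 * size g) *: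
   (B^`N(k) \Po affine (b%:R ^- size g) (xval R g))) N.
Proof.
rewrite /P_ (psum_raddf _ (nderivn k)); apply: eq_psum => g _ /=.
by rewrite nderivnZ nderivn_comp_affine scalerA exprVn -exprM mulSn bpowD mulnC.
Qed.

(** The eigenvalue equation is only given on [0,1], but the coefficients converge, so it extends to
    every real x. Points outside [0,1] are needed when phi_g0 is inverted. *)
Lemma eigen_nderivn_cvg k x :
  psum G (fun g => b%:R ^- (k.+1 * size g) * B^`N(k).[phi g x]) @ \oo
   --> lam m.+1 * B^`N(k).[x].
Proof.
rewrite [X in X @ \oo --> _](_ : _ = fun N => (P_ N)^`N(k).[x]).
  rewrite -hornerZ -nderivnZ.
  exact: (@nderivn_horner_cvg R P_ (lam m.+1 *: B) m.+1 P_size lB_size P_cvg).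
apply/funext => N; rewrite nderivn_psum -[RHS]/(horner_eval x _) psum_raddf.
apply: eq_psum => g _ /=.
by rewrite /horner_eval hornerZ horner_comp_affine /phi addrC.
Qed.

Lemma eigen_poly_integral_cvg (mu : {measure set (measurableTypeR R) -> \bar R}) k :
    (mu I01 < +oo)%E ->
  psum G (fun g => b%:R ^- (k.+1 * size g) *
     poly_integral mu I01 (B^`N(k) \Po affine (b%:R ^- size g) (xval R g))) @ \oo
   --> lam m.+1 * poly_integral mu I01 B^`N(k).
Proof.
move=> muI; have I0 : I01 `<=` `[0, 1]%classic by [].
rewrite [X in X @ \oo --> _](_ : _ = fun N => poly_integral mu I01 (P_ N)^`N(k)).
  rewrite -(poly_integralZ mI01 muI I0) -nderivnZ.
  exact: (@nderivn_poly_integral_cvg R P_ (lam m.+1 *: B) m.+1 P_size lB_size P_cvg).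
apply/funext => N; rewrite nderivn_psum /psum (poly_integral_sum mI01 muI I0).
apply: eq_bigr => n _; rewrite /cterm.
case: pickle_inv => [g|]; last exact/esym/(poly_integral0 mI01 muI I0).
by case: asboolP => _; [rewrite (poly_integralZ mI01 muI I0)|rewrite (poly_integral0 mI01 muI I0)].
Qed.

End Eigenpoly.

End Transfer.

(** * Growth of the eigenpolynomials *)

Lemma uniform_lt (R : realType) (Q : nat -> R -> Prop) n :
  (forall m, exists M, Q m M) -> (forall m M M', M <= M' -> Q m M -> Q m M') ->
  exists M, forall m, (m < n)%N -> Q m M.
Proof.
move=> QM mono; elim: n => [|n [M IH]]; first by exists 0.
have [M' h] := QM n; exists (Num.max M M') => m; rewrite ltnS leq_eqVlt.
case/orP => [/eqP ->|/IH hm]; [apply: mono h|apply: mono hm];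
  by rewrite le_max lexx ?orbT.
Qed.

(** C(m,k) d^k is a single term of the binomial expansion of (1+d)^m. *)
Lemma bin_le_expr (R : realType) (d : R) m k : 0 < d ->
  'C(m, k)%:R <= d ^- k * (1 + d) ^+ m.
Proof.
move=> d0; have d0' := ltW d0; have [km|mk] := leqP k m; last first.
  by rewrite bin_small// mulr_ge0 ?invr_ge0 ?exprn_ge0 ?addr_ge0.
rewrite ler_pdivlMl ?exprn_gt0// exprDn (bigD1 (Ordinal (km : (k < m.+1)%N)))//=.
rewrite expr1n mul1r mulr_natr lerDl; apply: sumr_ge0 => i _.
by rewrite expr1n mul1r mulrn_wge0// exprn_ge0.
Qed.

Lemma geometric_small (R : realType) (a z e : R) : 0 <= z < 1 -> 0 < e ->
  exists N, forall n, (N <= n)%N -> a * z ^+ n <= e.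
Proof.
move=> /andP[z0 z1] e0.
have h : a * z ^+ n @[n --> \oo] --> (0 : R).
  rewrite -(mulr0 a); apply: cvgMl_tmp; apply: cvg_expr.
  by rewrite ger0_norm.
have [N _ hN] := cvgr_le _ h _ e0.
by exists N => n Nn; exact: hN.
Qed.

Lemma nderivn_top (R : realType) (p : {poly R}) d :
  size p = d.+1 -> p^`N(d) = (lead_coef p)%:P.
Proof.
move=> pd; apply/polyP => i; rewrite coef_nderivn coefC lead_coefE pd /=.
case: i => [|i] /=; first by rewrite addn0 binn.
by rewrite nth_default ?mul0rn// pd addnS ltnS leq_addr.
Qed.

Section EigenpolyGrowth.
Variables (R : realType) (b : nat) (w : word b).
Hypotheses (b_gt1 : (1 < b)%N) (w_gt0 : (0 < size w)%N).
Variable nu : nat -> probability (measurableTypeR R) R.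
Hypothesis nuP : forall j : nat, (1 <= j)%N -> is_nu w j (nu j).
Variable B : nat -> {poly R}.
Hypothesis BP : forall m : nat, is_B w m (B m).
Local Notation I01 := (`[0%R, 1%R]%classic : set (measurableTypeR R)).
Local Notation G := (langG w).
Local Notation lam := (lambda R w).
Local Notation E j p := (poly_integral (nu j) I01 p).
Local Notation bpow n := (b%:R ^- n : R).

Let b_gt0 : 0 < b%:R :> R. Proof. by rewrite ltr0n ltnW. Qed.

Let bpow0 n : 0 < bpow n. Proof. exact: bpow_gt0. Qed.
Let bpow0' n : 0 <= bpow n. Proof. exact: ltW. Qed.
Local Hint Resolve bpow0 bpow0' : core.

Let I0 : I01 `<=` `[0, 1]%classic. Proof. by []. Qed.

Let nufin j : (((nu j.+1) : {measure set (measurableTypeR R) -> \bar R}) I01 < +oo)%E.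
Proof. exact: (@nuI01_fin R b w j.+1 (nu j.+1) (nuP (ltn0Sn j))). Qed.

Let mI : measurable I01. Proof. exact: mI01. Qed.

Let EZ j a p : E j.+1 (a *: p) = a * E j.+1 p.
Proof. exact: (poly_integralZ mI (nufin j) I0). Qed.

Let EB j p q : E j.+1 (p - q) = E j.+1 p - E j.+1 q.
Proof. exact: (poly_integralB mI (nufin j) I0). Qed.

Let EC j a : E j.+1 a%:P = a.
Proof. exact: (nu_poly_integral_C (nuP (ltn0Sn j))). Qed.

Let Ele j p M : (forall x, 0 <= x <= 1 -> `|p.[x]| <= M) -> `|E j.+1 p| <= M.
Proof. exact: (nu_poly_integral_le (nuP (ltn0Sn j))). Qed.

Lemma size_eigenpoly m : size (B m) = m.+1.
Proof. by have [_ s _] := BP m. Qed.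

(** The functional is sigma_(k+1), the factor 1/k! being part of the normalised derivative. For k >
    m the derivative is 0, and for k = m it is the constant 1 since B_m is monic. *)
Lemma biorthogonal k m : E k.+1 (B m)^`N(k) = (k == m)%:R.
Proof.
have [km|km|<-] := ltngtP k m; last first.
- rewrite (nderivn_top (size_eigenpoly k)).
  by have [/monicP -> _ _] := BP k; rewrite EC.
- by rewrite nderivn_poly0 ?size_eigenpoly// (poly_integral0 mI (nufin k) I0).
(* For k < m one sequence has two limits, by invariance of nu_(k+1) and by the eigenvalue equation
   of B_m; as the eigenvalues differ, the integral vanishes. *)
have c1 := @nu_cvg R b w w_gt0 b_gt1 k.+1 (nu k.+1) (ltn0Sn k) (nuP (ltn0Sn k)) (B m)^`N(k).
have c2 := @eigen_poly_integral_cvg R b w w_gt0 b_gt1 m (B m) (BP m) (nu k.+1) k (nufin k).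
have /eqP : lam k.+1 * E k.+1 (B m)^`N(k) = lam m.+1 * E k.+1 (B m)^`N(k).
  exact: (@cvg_unique _ (@Rhausdorff R) _ _ _ _ c1 c2).
rewrite -subr_eq0 -mulrBl mulf_eq0 => /orP[|/eqP -> //].
by rewrite subr_eq0 gt_eqF//; exact: lambda_lt.
Qed.

(** By biorthogonality all functionals of index at most N vanish on the difference r. If r had
    degree d, the functional of index d+1 would return its leading coefficient; hence r = 0. *)
Lemma eigen_expansion (p : {poly R}) N : (size p <= N)%N ->
  p = \sum_(j < N) E j.+1 p^`N(j) *: B j.
Proof.
move=> pN; apply/eqP; rewrite -subr_eq0; set r := _ - _.
have rN : (size r <= N)%N.
  rewrite (leq_trans (size_polyD _ _))// geq_max pN size_polyN.
  apply: (leq_trans (size_sum _ _ _)); apply/bigmax_leqP => j _.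
  by rewrite (leq_trans (size_scale_leq _ _))// size_eigenpoly.
have rE k : (k < N)%N -> E k.+1 r^`N(k) = 0.
  move=> kN; rewrite nderivnB EB raddf_sum (poly_integral_sum mI (nufin k) I0).
  rewrite (bigD1 (Ordinal kN))//= big1 ?addr0; last first.
    move=> j /negbTE jk; rewrite linearZ /= EZ biorthogonal.
    by rewrite -[k == j](eq_sym (j : nat)) (_ : (j == k :> nat) = false) ?mulr0.
  by rewrite linearZ /= EZ biorthogonal eqxx mulr1 subrr.
case sr : (size r) => [|d]; first by rewrite -size_poly_eq0 sr.
have dN : (d < N)%N by rewrite -sr.
by have := rE d dN; rewrite (nderivn_top sr) EC => /eqP; rewrite lead_coef_eq0.
Qed.

Variable g0 : word b.
Hypothesis Gg0 : G g0.
Hypothesis g0_suffix : forall g, G g ->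
  exists2 u, g = u ++ g0 & (g <> g0 -> (0 < size u)%N).
Local Notation l0 := (size g0).

Let l0_gt0 : (0 < l0)%N. Proof. exact: langG_size_gt0 Gg0. Qed.

Let lam1_ge0 : 0 <= lam 1. Proof. exact: lambda_ge0. Qed.

Lemma size_langG_ge g : G g -> g <> g0 -> (l0 < size g)%N.
Proof.
move=> /g0_suffix[u -> h] /h; rewrite size_cat.
by move=> u0; rewrite -[X in (X < _)%N]add0n ltn_add2r.
Qed.

(* All words of G but g0 are longer than g0, so g0 dominates for large j. *)
Lemma eigen_split j (F : word b -> R) (K l : R) : 0 <= K ->
  (forall g, G g -> g <> g0 -> `|F g| <= K) ->
  psum G (fun g => bpow (j.+1 * size g) * F g) @ \oo --> l ->
  `|l - bpow (j.+1 * l0) * F g0| <= K * lam 1 * bpow (j * l0.+1).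
Proof.
move=> K0 FK cl.
have c : `|psum G (fun g => bpow (j.+1 * size g) * F g) N
    - bpow (j.+1 * l0) * F g0| @[N --> \oo] --> `|l - bpow (j.+1 * l0) * F g0|.
  by apply: cvg_norm; apply: cvgB => //; exact: cvg_cst.
apply: (ler_cvg_to c (cvg_cst _)).
exists (pickle g0).+1 => // N /= hN.
rewrite (psumD1 _ Gg0 hN) addrC addKr.
apply: le_trans (ler_norm_psum _ _ _) _.
apply: (@le_trans _ _ (psum (G `\ g0)
    (fun g => (K * bpow (j * l0.+1)) * bpow (size g)) N)).
  apply: le_psum => g [Gg gg0].
  (* One factor b^-|g| is kept, to be summed to at most lambda_1; the j others are bounded through
     |g| >= |g0| + 1. *)
  rewrite normrM ger0_norm// mulSn addnC bpowD mulrC mulrA.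
  rewrite ler_wpM2r// ler_pM// ?FK// ?bpow_le//.
  by rewrite leq_mul2l (size_langG_ge Gg gg0) orbT.
rewrite psumZ mulrAC ler_wpM2r// ler_wpM2l//.
have : psum G (fun g => bpow (1 * size g)) N <= lam 1.
  by apply: psum_le_fine => //; exact: bpow_langG_fin.
rewrite (psumD1 _ Gg0 hN) (eq_psum (g := fun g => bpow (size g))); last first.
  by move=> g _; rewrite mul1n.
by apply: le_trans; rewrite lerDr.
Qed.

Lemma lambda_le m : lam m.+1 <= bpow (m * l0) * lam 1.
Proof.
have c2 : bpow (m * l0) * psum G (fun g => bpow (1 * size g)) N @[N --> \oo]
    --> bpow (m * l0) * lam 1.
  by apply: cvgMl_tmp; exact: lambda_cvg.
apply: (ler_cvg_to (lambda_cvg w_gt0 b_gt1 (ltn0Sn m)) c2).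
apply: nearW => N; rewrite -psumZ; apply: le_psum => g Gg.
rewrite mul1n mulSn addnC bpowD ler_wpM2r// bpow_le// leq_mul2l.
by have [u -> _] := g0_suffix Gg; rewrite size_cat leq_addl orbT.
Qed.

Let c : R := xval R g0 / (1 - bpow l0).

Let bl0_half : bpow l0 <= 2^-1.
Proof.
apply: le_trans (bpow_le R b_gt1 l0_gt0) _.
by rewrite expr1 lef_pV2 ?posrE// ler_nat.
Qed.

Let c01 : 0 <= c <= 1.
Proof.
have d0 : 0 < 1 - bpow l0 by have := bl0_half; lra.
rewrite /c divr_ge0 ?xval_ge0 ?(ltW d0)//= ler_pdivrMr// mul1r lerBrDr.
exact: xval_le.
Qed.

Lemma phi_fixpoint x : phi g0 x = c + bpow l0 * (x - c).
Proof.
have d0 : 1 - bpow l0 != 0 by rewrite gt_eqF//; have := bl0_half; lra.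
by rewrite /phi /c; move: (bpow l0) d0 => z d0; field.
Qed.

Definition centered n : {poly R} := 'X^n \Po affine 1 (- c).

Lemma horner_centered n x : (centered n).[x] = (x - c) ^+ n.
Proof. by rewrite horner_comp_affine hornerXn mul1r. Qed.

Lemma nderivn_centered n k : (centered n)^`N(k) = 'C(n, k)%:R *: centered (n - k).
Proof.
by rewrite /centered nderivn_comp_affine nderivnXn expr1n scale1r -scaler_nat comp_polyZ.
Qed.

Lemma size_centered n : (size (centered n) <= n.+1)%N.
Proof. by rewrite (leq_trans (size_comp_affine _ _ _))// size_polyXn. Qed.

Lemma dist_fixpoint x : 0 <= x <= 1 -> `|x - c| <= 1.
Proof. by move=> /andP[? ?]; have /andP[? ?] := c01; rewrite ler_norml; lra. Qed.

(** In the invariance relation g0 multiplies the moment by b^-(n|g0|) <= 1/2, so moving its term to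
    the left leaves at least half the weight u = b^-((j+1)|g0|) in front of the moment. The other
    words total at most lambda_1 b^|g0| b^-j u; dividing gives the bound and its factor 2. *)
Lemma moment_le j n : (0 < n)%N ->
  `|E j.+1 (centered n)| <= 2 * b%:R ^+ l0 * lam 1 * bpow j.
Proof.
move=> n0; set M := E _ _.
have := @nu_cvg R b w w_gt0 b_gt1 j.+1 (nu j.+1) (ltn0Sn j) (nuP (ltn0Sn j)) (centered n).
move=> /(@eigen_split j (fun g => E j.+1 (centered n \Po affine (bpow (size g)) (xval R g))) 1).
have h x : 0 <= x <= 1 -> `|(centered n).[x]| <= 1.
  by move=> x01; rewrite horner_centered normrX exprn_ile1// dist_fixpoint.
move=> /(_ ler01); rewrite mul1r => H.
have {H} : `|lam j.+1 * M - bpow (j.+1 * l0) * (bpow (l0 * n) * M)|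
    <= lam 1 * bpow (j * l0.+1).
  rewrite (_ : bpow (l0 * n) * M = E j.+1 (centered n \Po affine (bpow l0) (xval R g0))).
    apply: H => g _ _; apply: Ele => x x01.
    by rewrite horner_comp_affine; apply: h; rewrite addrC; exact: (phi_01 b_gt1 g).
  rewrite -EZ /poly_integral; apply: eq_Rintegral => x _.
  rewrite horner_comp_affine hornerZ !horner_centered.
  have -> : bpow l0 * x + xval R g0 = phi g0 x by rewrite addrC.
  by rewrite phi_fixpoint [c + _]addrC addrK exprMn exprM exprVn.
have uE : bpow (j * l0.+1) = bpow (j.+1 * l0) * (b%:R ^+ l0 * bpow j).
  rewrite mulnS mulSn !bpowD; field.
  by rewrite !expf_neq0 ?gt_eqF.
have u_le : bpow (j.+1 * l0) <= lam j.+1 by exact: lambda_ge.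
have v_le : bpow (l0 * n) <= 2^-1.
  by apply: le_trans (bpow_le R b_gt1 _) bl0_half; rewrite leq_pmulr.
rewrite uE.
rewrite (_ : _ - _ = (lam j.+1 - bpow (j.+1 * l0) * bpow (l0 * n)) * M); last by ring.
rewrite normrM.
move: (bpow0 (j.+1 * l0)) u_le v_le.
move: (bpow (j.+1 * l0)) (bpow (l0 * n)) (b%:R ^+ l0) => u v z.
move=> u0 u_le v_le hM; have uv : u * v <= u * 2^-1 by rewrite ler_wpM2l// ltW.
rewrite -(ler_pM2l (x := u * 2^-1)); last by rewrite mulr_gt0.
apply: (le_trans (y := `|lam j.+1 - u * v| * `|M|)).
  by rewrite ler_wpM2r// ger0_norm; lra.
apply: le_trans hM _; rewrite le_eqVlt; apply/orP; left; apply/eqP.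
by move: (bpow j) (lam 1) => y t; field.
Qed.

(** This is [eigen_expansion] for (x-c)^m solved for B_m, whose coefficient is 1; the coefficient of
    B_j is a binomial times the moment of order m-j of nu_(j+1). *)
Lemma eigen_recursion k m x :
  (B m)^`N(k).[x] = (centered m)^`N(k).[x] -
    \sum_(j < m) 'C(m, j)%:R * E j.+1 (centered (m - j)) * (B j)^`N(k).[x].
Proof.
have e := eigen_expansion (size_centered m).
have c1 : centered 0 = 1%:P by rewrite /centered expr0 comp_polyC.
suff -> : (centered m)^`N(k).[x] = \sum_(j < m)
    'C(m, j)%:R * E j.+1 (centered (m - j)) * (B j)^`N(k).[x] + (B m)^`N(k).[x].
  by rewrite addrC addKr.
rewrite {1}e big_ord_recr /= [(centered m)^`N(m)]nderivn_centered.
rewrite subnn binn scale1r c1 EC scale1r nderivnD hornerD; congr (_ + _).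
rewrite -[LHS]/(horner_eval x (nderivn k _)) !raddf_sum; apply: eq_bigr => j _.
by rewrite /= nderivn_centered EZ linearZ /horner_eval hornerZ.
Qed.

(* Induction on m in eigen_recursion: with moments O(b^-j), the sum contributes
   O((1 + rho/b)^m), which is O((3/4)^m rho^m) as soon as rho >= 4. *)
Lemma eigen_crude_bound k (d r : R) : 0 < d -> 1 <= r -> 4 <= (1 + d) * r ->
  exists2 M, 0 <= M & forall m x, `|x - c| <= r ->
    `|(B m)^`N(k).[x]| <= M * ((1 + d) * r) ^+ m.
Proof.
move=> d0 r1; set rho := (1 + d) * r => rho4.
have rho0 : 0 < rho by lra.
pose C0 := 2 * b%:R ^+ l0 * lam 1.
have C00 : 0 <= C0 by rewrite !mulr_ge0// exprn_ge0.
have dk : 0 <= d ^- k by rewrite invr_ge0 exprn_ge0// ltW.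
have step m x : `|x - c| <= r -> `|(B m)^`N(k).[x]| <= d ^- k * rho ^+ m +
    C0 * \sum_(j < m) 'C(m, j)%:R * bpow j * `|(B j)^`N(k).[x]|.
  move=> xr; rewrite eigen_recursion; apply: le_trans (ler_normB _ _) _.
  apply: lerD.
    rewrite nderivn_centered hornerZ horner_centered normrM normr_nat normrX.
    apply: (le_trans (y := d ^- k * (1 + d) ^+ m * r ^+ m)); last first.
      by rewrite /rho exprMn mulrA.
    apply: ler_pM; rewrite ?exprn_ge0//; first exact: bin_le_expr.
    apply: (le_trans (y := r ^+ (m - k))).
      by rewrite lerXn2r// nnegrE// (le_trans _ r1).
    by rewrite ler_weXn2l// leq_subr.
  apply: le_trans (ler_norm_sum _ _ _) _; rewrite mulr_sumr; apply: ler_sum => j _.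
  rewrite !normrM normr_nat [leRHS]mulrA ler_wpM2r// mulrCA ler_wpM2l//.
  by apply: moment_le; rewrite subn_gt0.
(* From the index [N] on, the sum in [step] accounts for at most half of the claimed bound. *)
have [|//|N hN] := @geometric_small R C0 (3 / 4) (2^-1).
  by apply/andP; split; lra.
have [||M0 hM0] := @uniform_lt R (fun m M => forall x, `|x - c| <= r ->
    `|(B m)^`N(k).[x]| <= M * rho ^+ m) N.
- move=> m; have [M' hM'] := poly_bounded (B m)^`N(k) (r + 1).
  exists (M' / rho ^+ m) => x xr; rewrite divfK ?expf_neq0 ?gt_eqF//; apply: hM'.
  have /andP[? ?] := c01; move: xr; rewrite !ler_norml => /andP[? ?]; apply/andP; split; lra.
- move=> m M M' MM' h x xr; apply: le_trans (h x xr) _.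
  by rewrite ler_wpM2r// exprn_ge0// ltW.
(* [M0] settles the indices below [N]; the other entry lets the leading term of [step] fit in the
   remaining half. *)
pose M := Num.max M0 (2 * d ^- k).
have M0M : M0 <= M by rewrite le_max lexx.
have dM : 2 * d ^- k <= M by rewrite le_max lexx orbT.
have Mge0 : 0 <= M by apply: le_trans dM; rewrite mulr_ge0.
exists M => // m x xr; elim/ltn_ind: m => m IH.
have rm : 0 <= rho ^+ m by rewrite exprn_ge0// ltW.
have [mN|Nm] := ltnP m N.
  by apply: le_trans (hM0 m mN x xr) _; rewrite ler_wpM2r.
apply: le_trans (step m x xr) _.
have S : \sum_(j < m) 'C(m, j)%:R * bpow j * `|(B j)^`N(k).[x]| <=
    M * (3 / 4) ^+ m * rho ^+ m.
  (* The term j = m is added to complete the expansion of (1 + rho/b)^m; then 1 + rho/b <= 1 + rho/2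
     <= (3/4) rho because rho >= 4. *)
  apply: (le_trans (y := M * \sum_(j < m.+1) 'C(m, j)%:R * (rho / b%:R) ^+ j)).
    rewrite big_ord_recr /= mulrDr ler_wpDr//.
      by rewrite !mulr_ge0// exprn_ge0// divr_ge0// ltW.
    rewrite mulr_sumr; apply: ler_sum => j _.
    have -> : M * ('C(m, j)%:R * (rho / b%:R) ^+ j) =
        'C(m, j)%:R * bpow j * (M * rho ^+ j) by rewrite expr_div_n; ring.
    by rewrite ler_wpM2l ?mulr_ge0// IH.
  rewrite (eq_bigr (fun j : 'I_m.+1 => 1 ^+ (m - j) * (rho / b%:R) ^+ j *+ 'C(m, j))).
    rewrite -exprDn -mulrA -exprMn ler_wpM2l// lerXn2r ?nnegrE//.
    - by rewrite addr_ge0// divr_ge0// ltW.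
    - by rewrite mulr_ge0 ?(ltW rho0)//; lra.
    have : rho / b%:R <= rho / 2.
      by rewrite ler_wpM2l ?(ltW rho0)// lef_pV2 ?posrE// ler_nat.
    lra.
  by move=> j _; rewrite expr1n mul1r mulr_natl.
have h1 : C0 * \sum_(j < m) 'C(m, j)%:R * bpow j * `|(B j)^`N(k).[x]| <=
    M / 2 * rho ^+ m.
  apply: le_trans (ler_wpM2l C00 S) _.
  rewrite !mulrA ler_wpM2r// mulrAC [leRHS]mulrC ler_wpM2r//; exact: hN.
have h2 : d ^- k * rho ^+ m <= M / 2 * rho ^+ m by rewrite ler_wpM2r//; lra.
lra.
Qed.

Lemma xval_cat (u v : word b) : xval R (u ++ v) = xval R u + bpow (size u) * xval R v.
Proof.
rewrite /xval nval_cat// natrD natrM natrX size_cat exprD; field.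
by rewrite !expf_neq0 ?gt_eqF.
Qed.

Lemma phi_cat (u v : word b) (x : R) : phi (u ++ v) x = phi u (phi v x).
Proof. by rewrite /phi xval_cat size_cat bpowD; ring. Qed.

(** With q = b^-|u|, both x(u) and (1-q)c lie in [0, 1-q], so the distance to c is at most (1-q) +
    qr, which is at most r as soon as r >= 1. *)
Lemma phi_ball (u : word b) r y : 1 <= r -> `|y - c| <= r -> `|phi u y - c| <= r.
Proof.
move=> r1 yr; have /andP[c0 c1] := c01.
have x0 := xval_ge0 R u; have x1 := xval_le R b_gt1 u.
have q0 := bpow0 (size u); rewrite /phi.
move: (xval R u) (bpow (size u)) x0 x1 q0 => z q x0 x1 q0.
have -> : z + q * y - c = (z - (1 - q) * c) + q * (y - c) by ring.
apply: le_trans (ler_normD _ _) _.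
have h1 : `|z - (1 - q) * c| <= 1 - q by rewrite ler_norml; nra.
have h2 : `|q * (y - c)| <= q * r by rewrite normrM gtr0_norm// ler_wpM2l// ltW.
apply: le_trans (lerD h1 h2) _; nra.
Qed.

(* At x = phi_g0^-1(z), with z a maximum point on the ball of radius r, every
   other phi_g x is again in that ball. *)
Lemma eigen_refine k m r Y : lam 1 * b%:R ^+ l0 * bpow k <= 2^-1 -> 1 <= r ->
  (forall x, `|x - c| <= b%:R ^+ l0 * r -> `|(B m)^`N(k).[x]| <= Y) ->
  forall x, `|x - c| <= r ->
    `|(B m)^`N(k).[x]| <= 2 * b%:R ^+ (k.+1 * l0) * lam 1 * bpow (m * l0) * Y.
Proof.
move=> hk r1 hY; set P := (B m)^`N(k).
have cr : c - r <= c + r by lra.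
have [|z zI hz] := @EVT_max R (fun x => `|P.[x]|) _ _ cr.
  apply: continuous_subspaceT => x; apply: cvg_norm; exact: continuous_horner.
suff H : `|P.[z]| <= 2 * b%:R ^+ (k.+1 * l0) * lam 1 * bpow (m * l0) * Y.
  move=> x xr; apply: le_trans H; apply: hz; rewrite in_itv /=.
  by move: xr; rewrite ler_norml => /andP[? ?]; apply/andP; split; lra.
have zr : `|z - c| <= r.
  by move: zI; rewrite in_itv /= ler_norml => /andP[? ?]; apply/andP; split; lra.
pose x := c + b%:R ^+ l0 * (z - c).
have bl : b%:R ^+ l0 != 0 :> R by rewrite expf_neq0// gt_eqF.
have xc : x - c = b%:R ^+ l0 * (z - c) by rewrite /x; ring.
have phix : phi g0 x = z.
  by rewrite phi_fixpoint xc mulrA mulVf// mul1r addrC subrK.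
have Px : `|P.[x]| <= Y.
  apply: hY; rewrite xc normrM ger0_norm ?exprn_ge0//.
  by rewrite ler_wpM2l// exprn_ge0.
have cP := @eigen_nderivn_cvg R b w w_gt0 b_gt1 m (B m) (BP m) k x.
have := @eigen_split k (fun g => P.[phi g x]) `|P.[z]| _ (normr_ge0 _) _ cP.
rewrite phix => H; have {}H : `|lam m.+1 * P.[x] - bpow (k.+1 * l0) * P.[z]| <=
    `|P.[z]| * lam 1 * bpow (k * l0.+1).
  apply: H => g /g0_suffix[u -> _] _; apply: hz.
  rewrite phi_cat phix in_itv /=.
  by have := phi_ball u r1 zr; rewrite ler_norml => /andP[? ?]; apply/andP; split; lra.
have kE : bpow (k * l0.+1) = bpow (k.+1 * l0) * (b%:R ^+ l0 * bpow k).
  by rewrite mulnS mulSn !bpowD; field; rewrite !expf_neq0 ?gt_eqF.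
have lm := lambda_le m.
move: H hk Px lm; rewrite kE -(exprVn _ (k.+1 * l0)) exprVn.
set q := bpow (k.+1 * l0) => H hk Px lm.
have q0 : 0 < q by exact: bpow0.
have -> : b%:R ^+ (k.+1 * l0) = q^-1 by rewrite /q invrK.
have h1 : q * `|P.[z]| <= lam m.+1 * Y + `|P.[z]| * lam 1 * (q * (b%:R ^+ l0 * bpow k)).
  have -> : q * `|P.[z]| = `|lam m.+1 * P.[x] - (lam m.+1 * P.[x] - q * P.[z])|.
    by rewrite subKr normrM gtr0_norm.
  apply: le_trans (ler_normB _ _) _; apply: lerD => //.
  by rewrite normrM gtr0_norm ?lambda_gt0// ler_wpM2l// ltW// lambda_gt0.
(* By the choice of k, the words other than g0 amount to at most half of the left side and are
   absorbed, whence the factor 2. *)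
have h2 : `|P.[z]| * lam 1 * (q * (b%:R ^+ l0 * bpow k)) <= q * `|P.[z]| * 2^-1.
  have -> : `|P.[z]| * lam 1 * (q * (b%:R ^+ l0 * bpow k)) =
    q * `|P.[z]| * (lam 1 * b%:R ^+ l0 * bpow k) by ring.
  by rewrite ler_wpM2l// mulr_ge0// ltW.
have Y0 : 0 <= Y by exact: le_trans Px.
(* The decay of lambda_(m+1) offsets the factor (b^|g0|)^m that the crude bound pays for the larger
   radius. *)
have h3 : lam m.+1 * Y <= bpow (m * l0) * lam 1 * Y by rewrite ler_wpM2r.
have h4 : q * `|P.[z]| <= 2 * (bpow (m * l0) * lam 1 * Y) by lra.
rewrite -(ler_pM2l q0); apply: le_trans h4 _.
rewrite le_eqVlt; apply/orP; left; apply/eqP.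
by move: (bpow (m * l0)) => y; field; rewrite gt_eqF.
Qed.

Lemma eigenpoly_bound d : 0 < d -> exists2 C, 0 <= C &
  forall m x, 0 <= x <= 1 -> `|(B m).[x]| <= C * (1 + d) ^+ m.
Proof.
move=> d0.
have [|//|k hk] := @geometric_small R (lam 1 * b%:R ^+ l0) b%:R^-1 2^-1.
  by rewrite invr_ge0 ler0n /= invf_lt1// ltr1n.
have {}hk : lam 1 * b%:R ^+ l0 * bpow k <= 2^-1 by rewrite -exprVn hk.
(* Since b^|g0| >= 2, two such factors reach the value 4 asked by the crude bound, and two
   refinements lead back to radius 1. *)
pose r2 : R := b%:R ^+ l0 * (b%:R ^+ l0 * 1).
have bl2 : 2 <= b%:R ^+ l0 :> R.
  apply: (le_trans (y := b%:R ^+ 1)); first by rewrite expr1 ler_nat.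
  by rewrite ler_weXn2l// ler1n ltnW.
have [||M M0 hM] := @eigen_crude_bound k d r2 d0; rewrite /r2; [nra|nra|].
pose C1 := 2 * b%:R ^+ (k.+1 * l0) * lam 1.
have C10 : 0 <= C1 by rewrite !mulr_ge0// exprn_ge0.
have top m x : 0 <= x <= 1 -> `|(B m)^`N(k).[x]| <= C1 ^+ 2 * M * (1 + d) ^+ m.
  move=> x01.
  have h1 := @eigen_refine k m (b%:R ^+ l0 * 1) _ hk _ (hM m).
  have h2 := @eigen_refine k m 1 _ hk (lexx 1) (h1 _).
  apply: le_trans (h2 _ x (dist_fixpoint x01)) _; first nra.
  rewrite -/C1 le_eqVlt; apply/orP; left; apply/eqP.
  rewrite /r2 mulr1; move: (C1) => D; rewrite !exprMn -!exprM [(l0 * m)%N]mulnC; field.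
  by rewrite expf_neq0// gt_eqF.
(* Descent on the order of the derivative: a derivative with mean zero equals, at x, the mean of its
   differences with other points, and these are controlled by the next derivative. Ordinary
   derivatives spare the factorials. *)
have low i m x : (k <= m)%N -> (i <= k)%N -> 0 <= x <= 1 ->
    `|(B m)^`(k - i).[x]| <= k`!%:R * (C1 ^+ 2 * M * (1 + d) ^+ m).
  move=> km; elim: i x => [|i IH] x ik x01.
    rewrite subn0 derivn_nderivn hornerZ normrM normr_nat ler_wpM2l//; exact: top.
  set D := (_ * (_ * _ * _)).
  have ki : (k - i = (k - i.+1).+1)%N by rewrite subnSK.
  have E0 : E (k - i.+1).+1 (B m)^`(k - i.+1) = 0.
    rewrite derivn_nderivn EZ biorthogonal (_ : (_ == m) = false) ?mulr0//.
    by rewrite ltn_eqF// (leq_trans _ km)// -ki leq_subr.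
  have -> : (B m)^`(k - i.+1).[x] =
      E (k - i.+1).+1 (((B m)^`(k - i.+1).[x])%:P - (B m)^`(k - i.+1)).
    by rewrite EB EC E0 subr0.
  apply: Ele => y y01; rewrite hornerD hornerN hornerC.
  have L : `|(B m)^`(k - i.+1).[x] - (B m)^`(k - i.+1).[y]| <= D * `|x - y|.
    apply: (@horner_lipschitz R _ `[0, 1]); rewrite ?in_itv//= => t.
    by rewrite in_itv /= -derivnS -ki; apply: IH; exact: ltnW.
  apply: le_trans L _; rewrite ler_piMr//.
    by rewrite !mulr_ge0// exprn_ge0//; lra.
  move: x01 y01 => /andP[? ?] /andP[? ?]; rewrite ler_norml; apply/andP; split; lra.
(* The descent uses mean zero at orders below k <= m; the finitely many m < k are bounded one by
   one. *)
have [||K hK] := @uniform_lt R (fun m K => forall x, 0 <= x <= 1 ->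
    `|(B m).[x]| <= K) k.
- move=> m; have [K hK] := poly_bounded (B m) 1; exists K => x /andP[x0 x1].
  by apply: hK; rewrite ger0_norm.
- by move=> m K K' KK' h x x01; apply: le_trans (h x x01) KK'.
exists (k`!%:R * (C1 ^+ 2 * M) + Num.max K 0).
  by rewrite addr_ge0 ?le_max ?lexx ?orbT// !mulr_ge0// exprn_ge0.
move=> m x x01; have d1 : 1 <= (1 + d) ^+ m by rewrite exprn_ege1//; lra.
have d1' : 0 <= (1 + d) ^+ m by exact: le_trans d1.
have [mk|km] := ltnP m k.
  apply: le_trans (hK m mk x x01) _; rewrite mulrDl ler_wpDl//.
    by rewrite !mulr_ge0// exprn_ge0.
  apply: (le_trans (y := Num.max K 0)); first by rewrite le_max lexx.
  by rewrite ler_peMr// le_max lexx orbT.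
have := low k m x km (leqnn k) x01; rewrite subnn derivn0 => /le_trans; apply.
by rewrite mulrDl -[k`!%:R * (C1 ^+ 2 * M) * _]mulrA lerDl mulr_ge0// le_max lexx orbT.
Qed.

End EigenpolyGrowth.

(** * Expansion of 1/(n+x) *)

Lemma sum_geometric_le (R : realType) (z : R) n : 0 <= z < 1 ->
  \sum_(i < n) z ^+ i <= (1 - z)^-1.
Proof.
move=> /andP[z0 z1]; have h : 0 < 1 - z by lra.
rewrite -[leRHS]mul1r ler_pdivlMr// mulrC -[1 - z]opprB mulNr -subrX1 opprB.
by rewrite lerBlDr lerDl exprn_ge0.
Qed.

(* negbin m N is the m-th derivative divided by m! of the N-th partial sum of
   1/(s-y) = sum_k y^k/s^(k+1); the junk power y^(k-m), k < m, has coefficient 0. *)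
Section NegativeBinomial.
Variables (R : realType) (s y : R).
Hypotheses (y0 : 0 <= y) (y1 : y <= 1) (s2 : 2 <= s).

Definition negbin m N : R := \sum_(k < N) 'C(k, m)%:R * y ^+ (k - m) * s ^- k.+1.

Let s_gt0 : 0 < s. Proof. exact: lt_le_trans s2. Qed.

Let s_neq0 : s != 0. Proof. by rewrite gt_eqF. Qed.

Lemma negbin_ge0 m N : 0 <= negbin m N.
Proof.
by apply: sumr_ge0 => k _; rewrite !mulr_ge0 ?exprn_ge0 ?invr_ge0// exprn_ge0// ltW.
Qed.

Lemma negbin0 N : (s - y) * negbin 0 N = 1 - y ^+ N * s ^- N.
Proof.
rewrite /negbin; elim: N => [|N IH]; first by rewrite big_ord0 !expr0; lra.
rewrite big_ord_recr /= mulrDr IH bin0 subn0 !exprS; field.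
by rewrite s_neq0 expf_neq0.
Qed.

(** Pascal's rule, by induction on N. It passes the truncation error from order m to order m+1. *)
Lemma negbinS m N : (s - y) * negbin m.+1 N =
  negbin m N - 'C(N, m.+1)%:R * y ^+ (N - m.+1) * s ^- N.
Proof.
rewrite /negbin; elim: N => [|N IH].
  by rewrite !big_ord0 bin0n /=; lra.
rewrite !big_ord_recr /= mulrDr IH binS natrD.
(* For N <= m the truncated subtractions disagree, but the binomial is 0. *)
have e : 'C(N, m.+1)%:R * y ^+ (N - m) = 'C(N, m.+1)%:R * (y * y ^+ (N - m.+1)).
  have [Nm|mN] := leqP N m; first by rewrite bin_small// !mul0r.
  by rewrite -exprS subnSK.
rewrite subSS ['C(N, m.+1)%:R + _]addrC [(_ + 'C(N, m.+1)%:R) * _]mulrDl e.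
move: (\sum_(i < N) _) => S1.
rewrite !exprS; move: (y ^+ _) (y ^+ _) (_%:R) (_%:R) => u v p q; field.
by rewrite s_neq0 expf_neq0.
Qed.

Let D m : R := \sum_(i < m.+1) 2 ^+ i.

(** Each order adds one boundary term and divides by s-y >= 1. The boundary term is at most 2^i
    (3/4)^N, as C(N,i) <= 2^i (3/2)^N and s^-N <= 2^-N. *)
Lemma negbin_error m N :
  0 <= (s - y) ^- m.+1 - negbin m N <= D m * (3 / 4) ^+ N.
Proof.
have sy1 : 1 <= s - y by move: y1 s2; lra.
have sy0 : 0 < s - y by lra.
have sy : 0 <= (s - y)^-1 <= 1 by rewrite invr_ge0 (ltW sy0) invf_le1.
have small i : 0 <= 'C(N, i)%:R * y ^+ (N - i) * s ^- N <= 2 ^+ i * (3 / 4) ^+ N.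
  rewrite !mulr_ge0 ?exprn_ge0 ?invr_ge0 ?exprn_ge0 ?(ltW s_gt0)//=.
  have -> : (3 / 4 : R) = (1 + 2^-1) * 2^-1 by field.
  rewrite exprMn mulrA; apply: ler_pM; rewrite ?mulr_ge0 ?exprn_ge0 ?invr_ge0//.
  - by rewrite exprn_ge0// ltW.
  - apply: (le_trans (y := 'C(N, i)%:R)).
      by rewrite ler_piMr// exprn_ile1.
    by have := @bin_le_expr R 2^-1 N i; rewrite exprVn invrK; apply; rewrite invr_gt0 ltr0n.
  - by rewrite -exprVn lerXn2r ?nnegrE ?invr_ge0 ?(ltW s_gt0)// lef_pV2 ?posrE.
have syn : s - y != 0 by rewrite gt_eqF.
have aux (x u v : R) : 0 <= x <= u -> 0 <= v <= 1 -> 0 <= x * v <= u.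
  move=> /andP[x0 xu] /andP[v0 v1]; rewrite mulr_ge0//=.
  by apply: le_trans xu; rewrite ler_piMr.
elim: m => [|m IH].
  have -> : (s - y) ^- 1 - negbin 0 N = 'C(N, 0)%:R * y ^+ (N - 0) * s ^- N * (s - y)^-1.
    rewrite bin0 subn0 mul1r expr1 -[negbin 0 N](mulKf syn).
    by rewrite negbin0; field; rewrite syn expf_neq0.
  rewrite /D big_ord1; exact: aux.
have -> : (s - y) ^- m.+2 - negbin m.+1 N = ((s - y) ^- m.+1 - negbin m N
    + 'C(N, m.+1)%:R * y ^+ (N - m.+1) * s ^- N) * (s - y)^-1.
  rewrite -[negbin m.+1 N](mulKf syn) negbinS exprS.
  by field; rewrite syn !expf_neq0.
apply: aux => //; rewrite /D big_ord_recr /= mulrDl.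
have /andP[a1 a2] := IH; have /andP[b1 b2] := small m.+1.
by rewrite addr_ge0//= lerD.
Qed.

End NegativeBinomial.

Section Expansion.
Variables (R : realType) (b : nat) (w : word b).
Hypotheses (b_gt1 : (1 < b)%N) (w_gt0 : (0 < size w)%N).
Hypothesis w_neq0 : ~~ is_zero_word w.
Variable nu : nat -> probability (measurableTypeR R) R.
Hypothesis nuP : forall j : nat, (1 <= j)%N -> is_nu w j (nu j).
Variable B : nat -> {poly R}.
Hypothesis BP : forall m : nat, is_B w m (B m).
Local Notation I01 := (`[0%R, 1%R]%classic : set (measurableTypeR R)).
Local Notation G := (langG w).
Local Notation lam := (lambda R w).
Local Notation E j p := (poly_integral (nu j) I01 p).
Local Notation bpow n := (b%:R ^- n : R).

Let mI : measurable I01. Proof. exact: mI01. Qed.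

Let I0 : I01 `<=` `[0, 1]%classic. Proof. by []. Qed.

Let nufin j : (((nu j.+1) : {measure set (measurableTypeR R) -> \bar R}) I01 < +oo)%E.
Proof. exact: (@nuI01_fin R b w j.+1 (nu j.+1) (nuP (ltn0Sn j))). Qed.

Section Fixed.
Variable n : nat.
Hypothesis n_gt0 : (0 < n)%N.

Let n1 : 1 <= n%:R :> R. Proof. by rewrite ler1n. Qed.

(** The absolute value makes the function continuous and bounded by 1 on the whole line without
    changing it on [0,1]. *)
Definition invpow j (x : R) : R := (n%:R + `|x|) ^- j.

Lemma measurable_invpow j : measurable_fun setT
  (invpow j : measurableTypeR R -> measurableTypeR R).
Proof.
apply: continuous_measurable_fun.
have c : continuous (fun x : R => n%:R + `|x|).
  by move=> x; apply: cvgD; [exact: cvg_cst|exact: norm_continuous].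
move=> x; apply: (@continuousV R R (fun x : R => (n%:R + `|x|) ^+ j)).
  by rewrite expf_neq0// gt_eqF// ltr_pwDl// (lt_le_trans ltr01).
apply: (@continuous_comp _ _ _ (fun x : R => n%:R + `|x|) (fun y : R => y ^+ j)).
  exact: c.
exact: exprn_continuous.
Qed.

Lemma invpowE j x : 0 <= x <= 1 -> invpow j x = (n%:R + x) ^- j.
Proof. by move=> /andP[x0 _]; rewrite /invpow ger0_norm. Qed.

Lemma invpow_ge0 j x : 0 <= invpow j x.
Proof. by rewrite invr_ge0 exprn_ge0// addr_ge0. Qed.

Lemma invpow_le1 j x : invpow j x <= 1.
Proof.
have p1 : 1 <= n%:R + `|x| by rewrite (le_trans n1)// lerDl.
by rewrite invf_le1 ?exprn_ege1// exprn_gt0// (lt_le_trans ltr01).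
Qed.

Lemma AintE j : Aint nu j n = \int[nu j]_(x in I01) invpow j x.
Proof. by apply: eq_Rintegral => x; rewrite inE /= in_itv => /invpowE ->. Qed.

Lemma invpow_integrable m j :
  (nu m.+1).-integrable I01 (EFin \o invpow j).
Proof.
apply: (bounded_integrable mI (nufin m) (M := 1)).
  by apply: (measurable_funS measurableT) => //; exact: measurable_invpow.
by move=> x _; rewrite ger0_norm ?invpow_ge0 ?invpow_le1.
Qed.

Lemma Aint_ge0 j : 0 <= Aint nu j n.
Proof. by rewrite AintE; apply: Rintegral_ge0 => x _; exact: invpow_ge0. Qed.

Lemma measurable_phi (g : word b) : measurable_fun setT
  (phi g : measurableTypeR R -> measurableTypeR R).
Proof.
rewrite (_ : phi g = horner (affine (bpow (size g)) (xval R g))).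
  exact: measurable_horner.
by apply/funext => x; rewrite /affine !hornerE /phi addrC.
Qed.

(** Invariance of nu_(m+1) is tested on (n+x)^-(m+1). As n >= 1 and phi_g >= b^-|g|, the term of g
    is at most (b^|g|+1)^-(m+1), hence at most (b^|g0|+1)^-m b^-|g|; on the other side lambda_(m+1)
    >= b^-((m+1)|g0|). *)
Lemma Aint_le g0 m : G g0 -> (forall g, G g -> (size g0 <= size g)%N) ->
  Aint nu m.+1 n <= (b%:R ^+ size g0 * lam 1) * (b%:R ^+ size g0 / (b%:R ^+ size g0 + 1)) ^+ m.
Proof.
move=> Gg0 g0min.
have mf := @measurable_invpow m.+1.
have := integral_nu b_gt1 (nuP (ltn0Sn m)) mf (fun x _ => invpow_ge0 m.+1 x).
rewrite -[X in (_ * X)%E]fineK; last exact: integrable_fin_num (invpow_integrable _ _).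
rewrite -/(Rintegral _ _ _) -AintE -EFinM => e.
pose t : R := b%:R ^+ size g0 + 1.
have b0 : 0 < b%:R :> R by rewrite ltr0n ltnW.
have t0 : 0 < t by rewrite addr_gt0// exprn_gt0.
have le1 : lam m.+1 * Aint nu m.+1 n <= t ^- m * lam 1.
  rewrite -lee_fin -e [in leRHS]EFinM.
  have -> : (lam 1)%:E = (\esum_(g in G) (bpow (1 * size g))%:E)%E.
    rewrite /lambda fineK// ge0_fin_numE; first exact: bpow_langG_fin.
    by apply: esum_ge0 => g _; rewrite lee_fin bpow_ge0.
  rewrite -ge0_esumZl; last 2 first.
  - by move=> g _; rewrite lee_fin bpow_ge0.
  - by rewrite invr_ge0 exprn_ge0// ltW.
  apply: le_esum => g Gg; rewrite mul1n.
  have ng := nval_langG b_gt1 w_gt0 w_neq0 Gg.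
  apply: (@le_trans _ _ ((bpow (m.+1 * size g))%:E *
      ((1 + bpow (size g)) ^- m.+1)%:E)%E).
    rewrite lee_pmul2l// ?lte_fin ?bpow_gt0//.
    rewrite -[leRHS]mule1 -(nuP (ltn0Sn m)).1 -integral_cst//.
    apply: ge0_le_integral => //.
    - by move=> x _; rewrite lee_fin invpow_ge0.
    - apply/measurable_EFinP; apply: (measurable_funS measurableT) => //.
      exact: (measurableT_comp mf (measurable_phi _)).
    move=> x /=; rewrite in_itv /= => /andP[x0 x1]; rewrite lee_fin.
    have px : bpow (size g) <= phi g x.
      rewrite /phi /xval -[leLHS]mul1r ler_wpDr ?mulr_ge0 ?bpow_ge0//.
      by rewrite ler_wpM2r ?bpow_ge0// ler1n.
    have pg := lt_le_trans (bpow_gt0 R b_gt1 (size g)) px.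
    have u0 : 0 < 1 + bpow (size g) by rewrite addr_gt0// bpow_gt0.
    rewrite /invpow (gtr0_norm pg) lef_pV2 ?posrE ?exprn_gt0//; last first.
      by rewrite addr_gt0// (lt_le_trans ltr01).
    by rewrite lerXn2r ?nnegrE ?(ltW u0)// ?lerD// addr_ge0// ltW.
  rewrite -EFinM lee_fin mulnC exprM -invfM -exprMn mulrDr mulr1 mulfV; last first.
    by rewrite expf_neq0// gt_eqF.
  have bg0 : 0 <= b%:R ^+ size g + 1 :> R by rewrite addr_ge0// exprn_ge0.
  rewrite exprSr invfM; apply: ler_pM; rewrite ?invr_ge0 ?exprn_ge0//.
    rewrite lef_pV2 ?posrE ?exprn_gt0 ?addr_gt0 ?exprn_gt0//.
    rewrite lerXn2r ?nnegrE ?addr_ge0 ?exprn_ge0 ?(ltW b0)// lerD2r.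
    by rewrite ler_weXn2l ?ler1n ?(ltnW b_gt1)// g0min.
  by rewrite lef_pV2 ?posrE ?addr_gt0 ?exprn_gt0// lerDl.
have lm : bpow (m.+1 * size g0) <= lam m.+1 by exact: lambda_ge.
have := le_trans (ler_wpM2r (Aint_ge0 m.+1) lm) le1.
rewrite -(ler_pM2l (x := b%:R ^+ (m.+1 * size g0))) ?exprn_gt0//.
rewrite mulrA mulfV ?mul1r ?expf_neq0 ?gt_eqF// => /le_trans; apply.
rewrite le_eqVlt; apply/orP; left; apply/eqP.
rewrite -/t expr_div_n mulSn exprD [(m * _)%N]mulnC exprM; field.
by rewrite expf_neq0// gt_eqF.
Qed.

Let s : R := n%:R + 1.

Let s2 : 2 <= s. Proof. by rewrite /s (_ : 2 = 1 + 1)// lerD2r. Qed.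

(** The Taylor polynomial of 1/(n+x) at x = 1, of degree less than N. *)
Definition geomp N : {poly R} :=
  \sum_(k < N) s ^- k.+1 *: ('X^k \Po affine (-1) 1).

Lemma size_geomp N : (size (geomp N) <= N)%N.
Proof.
apply: (leq_trans (size_sum _ _ _)); apply/bigmax_leqP => k _.
rewrite (leq_trans (size_scale_leq _ _))// (leq_trans (size_comp_affine _ _ _))//.
by rewrite size_polyXn.
Qed.

Lemma nderivn_geomp m N x :
  (geomp N)^`N(m).[x] = (-1) ^+ m * negbin s (1 - x) m N.
Proof.
rewrite /geomp /negbin -[LHS]/(horner_eval x (nderivn m _)) !raddf_sum mulr_sumr.
apply: eq_bigr => k _ /=; rewrite linearZ /= nderivn_comp_affine nderivnXn.
rewrite /horner_eval !hornerZ horner_comp_affine hornerMn hornerXn -mulr_natl.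
by rewrite mulN1r addrC; ring.
Qed.

(** The sign cancels the one from differentiating powers of 1-x, so [a] is the integral of [negbin],
    and [negbin_error] integrates. The bounds 0 <= a <= A_(m+1)(n) serve as domination below. *)
Lemma Aint_approx m N :
  let a := (-1) ^+ m * E m.+1 (geomp N)^`N(m) in
  0 <= a /\ 0 <= Aint nu m.+1 n - a <= (\sum_(i < m.+1) 2 ^+ i) * (3 / 4) ^+ N.
Proof.
move=> a.
pose q := (-1) ^+ m *: (geomp N)^`N(m).
have aE : a = E m.+1 q by rewrite /q (poly_integralZ mI (nufin m) I0).
have qE x : q.[x] = negbin s (1 - x) m N.
  by rewrite hornerZ nderivn_geomp mulrA -exprMn mulrNN mulr1 expr1n mul1r.
have y01 (x : R) : I01 x -> 0 <= x <= 1 by rewrite /= in_itv.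
have yb (x : R) : 0 <= x <= 1 -> 0 <= 1 - x /\ 1 - x <= 1.
  by move=> /andP[? ?]; split; lra.
have er (x : R) : 0 <= x <= 1 -> 0 <= invpow m.+1 x - q.[x] <=
    (\sum_(i < m.+1) 2 ^+ i) * (3 / 4) ^+ N.
  move=> x01; rewrite invpowE// qE; have [y0 y1] := yb x x01.
  have -> : n%:R + x = s - (1 - x) by rewrite /s; ring.
  exact: negbin_error.
have qi := horner_integrable mI (nufin m) I0 q.
have ii := invpow_integrable m m.+1.
split.
  rewrite aE; apply: Rintegral_ge0 => x /y01 /yb[y0 y1].
  by rewrite qE; exact: negbin_ge0.
rewrite aE AintE /poly_integral -RintegralB//.
have mr : measurable_fun I01 ((fun x => invpow m.+1 x - q.[x]) : measurableTypeR R -> measurableTypeR R).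
  apply: measurable_funB; last exact: measurable_horner.
  by apply: (measurable_funS measurableT) => //; exact: measurable_invpow.
apply/andP; split.
  by apply: Rintegral_ge0 => x /y01 /er/andP[].
apply: le_trans (ler_norm _) _.
have := ler_norm_Rintegral mI (nufin m) mr (M := (\sum_(i < m.+1) 2 ^+ i) * (3 / 4) ^+ N).
have -> : fine ((nu m.+1 : {measure set (measurableTypeR R) -> \bar R}) I01) = 1.
  by have := congr1 fine (nuP (ltn0Sn m)).1.
rewrite mulr1; apply => x /y01 /er/andP[? ?]; rewrite ger0_norm//.
Qed.

(** Expand the Taylor polynomial of length M+N in the B_m. Its first M coefficients tend to those of
    the series, and the N others are dominated by a geometric tail independent of N; then N goes to
    infinity. *)
Lemma eigen_series_approx (C K e t z : R) :
  0 <= C -> 0 <= e -> 0 <= t -> e * t <= z -> z < 1 ->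
  (forall m x, 0 <= x <= 1 -> `|(B m).[x]| <= C * e ^+ m) ->
  (forall m, Aint nu m.+1 n <= K * t ^+ m) ->
  forall M x, 0 <= x <= 1 ->
  `|(n%:R + x)^-1 - \sum_(m < M) (-1) ^+ m * Aint nu m.+1 n * (B m).[x]|
    <= C * K * z ^+ M / (1 - z).
Proof.
move=> C0 e0 t0 etz z1 BC AK M x x01.
have z0 : 0 <= z by apply: le_trans etz; rewrite mulr_ge0.
have K0 : 0 <= K by have := le_trans (Aint_ge0 1) (AK 0%N); rewrite expr0 mulr1.
have term_le m : Aint nu m.+1 n * `|(B m).[x]| <= C * K * z ^+ m.
  apply: (le_trans (y := (K * t ^+ m) * (C * e ^+ m))).
    by apply: ler_pM => //; [exact: Aint_ge0|exact: BC].
  rewrite mulrACA -exprMn [K * C]mulrC ler_wpM2l ?mulr_ge0//.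
  by rewrite lerXn2r ?nnegrE ?mulr_ge0// mulrC.
pose a m N := (-1) ^+ m * E m.+1 (geomp N)^`N(m).
(* The 1 accounts for the Taylor remainder of 1/(n+x), the sum for the errors on the first M
   coefficients. *)
pose H := 1 + \sum_(m < M) (\sum_(i < m.+1) 2 ^+ i) * `|(B m).[x]|.
have key N : `|(n%:R + x)^-1 - \sum_(m < M) (-1) ^+ m * Aint nu m.+1 n * (B m).[x]|
    <= C * K * z ^+ M / (1 - z) + H * (3 / 4) ^+ (M + N).
  have pE : (geomp (M + N)).[x] =
      \sum_(m < M + N) (-1) ^+ m * a m (M + N) * (B m).[x].
    rewrite {1}(eigen_expansion b_gt1 w_gt0 nuP BP (size_geomp (M + N))) horner_sum.
    by apply: eq_bigr => m _; rewrite hornerZ /a mulrA -exprMn mulrNN mulr1 expr1n mul1r.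
  have p0 : `|(n%:R + x)^-1 - (geomp (M + N)).[x]| <= (3 / 4) ^+ (M + N).
    rewrite -(nderivn0 (geomp _)) nderivn_geomp expr0 mul1r.
    have -> : n%:R + x = s - (1 - x) by rewrite /s; ring.
    have /andP[? ?] := x01.
    have := @negbin_error R s (1 - x) _ _ s2 0 (M + N).
    rewrite big_ord1 expr0 mul1r expr1 => /(_ _ _)/andP[||h1 h2]; [lra|lra|].
    by rewrite ger0_norm.
  set S := \sum_(m < M) _.
  have -> : (n%:R + x)^-1 - S = ((n%:R + x)^-1 - (geomp (M + N)).[x]) +
     ((\sum_(m < M) (-1) ^+ m * a m (M + N) * (B m).[x] - S) +
      \sum_(i < N) (-1) ^+ (M + i) * a (M + i)%N (M + N) * (B (M + i)).[x]).
    by rewrite pE big_split_ord /=; ring.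
  have h2 : `|\sum_(m < M) (-1) ^+ m * a m (M + N) * (B m).[x] - S| <=
      (\sum_(m < M) (\sum_(i < m.+1) 2 ^+ i) * `|(B m).[x]|) * (3 / 4) ^+ (M + N).
    rewrite /S -sumrB; apply: le_trans (ler_norm_sum _ _ _) _.
    rewrite mulr_suml; apply: ler_sum => m _; rewrite -mulrBl -mulrBr !normrM.
    rewrite normrX normrN1 expr1n mul1r mulrAC ler_wpM2r// distrC.
    by have [_ /andP[d0 d1]] := Aint_approx m (M + N); rewrite ger0_norm.
  have h3 : `|\sum_(i < N) (-1) ^+ (M + i) * a (M + i)%N (M + N) * (B (M + i)).[x]| <=
      C * K * z ^+ M / (1 - z).
    apply: le_trans (ler_norm_sum _ _ _) _.
    apply: (le_trans (y := C * K * z ^+ M * \sum_(i < N) z ^+ i)).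
      rewrite mulr_sumr; apply: ler_sum => i _; rewrite normrM normrM normrX normrN1 expr1n mul1r.
      rewrite -[leRHS]mulrA -exprD; apply: le_trans (term_le _).
      rewrite ler_wpM2r//; have [a0 /andP[d0 _]] := Aint_approx (M + i) (M + N).
      rewrite (ger0_norm (a0 : 0 <= a (M + i)%N (M + N)%N)) -subr_ge0; exact: d0.
    by rewrite ler_wpM2l ?mulr_ge0 ?exprn_ge0// sum_geometric_le// z0.
  apply: le_trans (ler_normD _ _) _.
  have := ler_normD (\sum_(m < M) (-1) ^+ m * a m (M + N) * (B m).[x] - S)
   (\sum_(i < N) (-1) ^+ (M + i) * a (M + i)%N (M + N) * (B (M + i)).[x]).
  rewrite /H mulrDl mul1r; lra.
apply/ler_addgt0Pr => r r0.
have [|N hN] := @geometric_small R H (3 / 4) r _ r0.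
  by apply/andP; split; lra.
by apply: le_trans (key N) _; rewrite lerD2l hN// leq_addl.
Qed.

End Fixed.

End Expansion.

(** * The series *)

Section Digits.
Variables (R : realType) (b : nat) (w : word b).
Hypotheses (b_gt1 : (1 < b)%N) (w_gt0 : (0 < size w)%N).
Implicit Types (g h v : word b).
Local Open Scope ereal_scope.

Let inv v : \bar R := ((nval v)%:R^-1)%:E.

Let inv_ge0 v : 0 <= inv v. Proof. by rewrite lee_fin invr_ge0. Qed.

(* The sum of 1/n over the n whose expansion is u followed by a word of L. *)
Definition tail_sum (L : set (word b)) (n : nat) : \bar R :=
  \esum_(g in L) (b%:R ^- size g * (n%:R + xval R g)^-1)%:E.

Lemma inv_nval_cat u v : (0 < nval u)%N ->
  inv (u ++ v) = (b%:R ^- size v * ((nval u)%:R + xval R v)^-1)%:E.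
Proof.
move=> u0; congr EFin; rewrite nval_cat// natrD natrM natrX /xval -invfM; congr (_^-1)%R.
by rewrite mulrDr mulrC mulrCA mulfV ?mulr1// expf_neq0// pnatr_eq0 -lt0n ltnW.
Qed.

Let V := [set v | first_digit v <> 0%N /\ langF w (behead v)].

(** In V only an occurrence at index 0 is possible. Without it, v is the expansion of an integer
    counted by I(b,w,0); with it, v is w followed by a word of R, which requires w_1 to be
    nonzero. *)
Lemma irwin_split :
  \esum_(v in V) inv v = irwin R w +
    (if first_digit w != 0%N then tail_sum (langR w) (nval w) else 0).
Proof.
have occV v : first_digit v <> 0%N ->
    (occ w v = prefix w v + occ w (behead v))%N.
  by case: v => // x v _; exact: occ_cons.
have nz v : first_digit v <> 0%N -> (0 < nval v)%N.
  by move=> v0; rewrite (leq_trans _ (nval_lead b_gt1 v0))// expn_gt0 ltnW.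
rewrite (esumID [set v | prefix w v])// addeC; congr (_ + _).
  rewrite /irwin (@reindex_esum _ _ _ (V `&` ~` [set v | prefix w v]) _ (@nval b))//.
  split=> [v [[v0 vF] /negP/negbTE nv]|u v|n [n0 [v [[<- v0] ov]]]].
  - split; first exact: nz.
    by exists v; split => //; rewrite occV// nv.
  - by rewrite !inE => -[[u0 _] _] [[v0 _] _]; exact: nval_lead_inj.
  exists v => //; move: ov; rewrite occV// => /eqP; rewrite addn_eq0 => /andP[/eqP p0 /eqP o0].
  by split=> //= pv; move: p0; rewrite pv.
have fd h : first_digit (w ++ h) = first_digit w by case: w w_gt0.
case: ifPn => [/eqP w0|/negPn/eqP w0]; last first.
  rewrite (_ : _ `&` _ = set0) ?esum_set0//; apply/seteqP; split=> // v [[v0 _]].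
  by move=> /= /prefixP[h vh]; apply: v0; rewrite vh fd.
rewrite (@reindex_esum _ _ _ (langR w) _ (fun h => w ++ h)); last first.
  split=> [h Rh|g h _ _ /eqP|v [[v0 vF] /= /prefixP[h vh]]].
  - split; last exact: prefix_prefix.
    split; first by rewrite fd.
    by rewrite (_ : behead _ = behead w ++ h); [exact/langR_behead|case: w w_gt0].
  - by rewrite eqseq_cat// eqxx => /eqP.
  exists h => //; apply/langR_behead => //; move: vF.
  by rewrite vh (_ : behead _ = behead w ++ h)//; case: w w_gt0.
apply: eq_esum => h _; apply: inv_nval_cat; exact: nz.
Qed.

(** A word of V is a nonzero digit followed by an arbitrary word of F. *)
Lemma digits_split :
  \esum_(v in V) inv v = \sum_(1 <= a < b) tail_sum (langF w) a.
Proof.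
pose I := [set a : 'I_b | val a <> 0%N].
have t0 (a : 'I_b) : 0 <= tail_sum (langF w) a.
  by apply: esum_ge0 => g _; rewrite lee_fin mulr_ge0 ?invr_ge0 ?exprn_ge0// addr_ge0// xval_ge0.
transitivity (\esum_(a in I) tail_sum (langF w) a).
  rewrite (@reindex_esum _ _ _ (I `*`` (fun=> langF w)) _ (fun p => p.1 :: p.2)).
    rewrite -(@esum_esum _ _ _ I (fun=> langF w) (fun a g => inv (a :: g)))//.
    apply: eq_esum => a a0; apply: eq_esum => g _.
    have na : nval [:: a] = a by rewrite /nval /= mul0n.
    by rewrite -cat1s inv_nval_cat na// lt0n; apply/eqP.
  split=> [[a g] []//|[a g] [a' g'] _ _ /= [-> ->]//|[|a g] [] //= a0 gF].
  by exists (a, g).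
rewrite esum_fset//; last exact: finite_finset.
rewrite (big_nat_widenl 1 0)// big_mkord [RHS]bigfs ?index_enum_uniq//; last first.
  by move=> a _; rewrite mem_index_enum.
rewrite [X in \sum_(a \in X) _ = _](_ : I = [set` fun a : 'I_b => (0 < a)%N])//.
by apply/seteqP; split=> a /=; rewrite /in_mem /= lt0n => /eqP.
Qed.

Lemma irwin_tail_sum :
  irwin R w + (if first_digit w != 0%N then tail_sum (langR w) (nval w) else 0)
  = \sum_(1 <= a < b) tail_sum (langF w) a.
Proof. by rewrite -irwin_split digits_split. Qed.

End Digits.

Lemma cvg_geometric_bound (R : realType) (u : nat -> R) (l c z : R) :
  0 <= z < 1 -> (forall n, `|l - u n| <= c * z ^+ n) -> u @ \oo --> l.
Proof.
move=> z01 h; apply/cvgrPdist_le => e e0.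
have [N hN] := geometric_small c z01 e0.
by exists N => // n /= Nn; apply: le_trans (h n) (hN n Nn).
Qed.

(** * Termwise integration against an atomic measure *)

Section AtomicSeries.
Variables (R : realType) (b : nat) (w : word b).
Hypotheses (b_gt1 : (1 < b)%N) (w_gt0 : (0 < size w)%N).
Variable nu : nat -> probability (measurableTypeR R) R.
Hypothesis nuP : forall j : nat, (1 <= j)%N -> is_nu w j (nu j).
Variable B : nat -> {poly R}.
Hypothesis BP : forall m : nat, is_B w m (B m).
Variable L : set (word b).
Hypothesis L_fin : (\esum_(g in L) (b%:R ^- size g : R)%:E < +oo)%E.
Local Notation Z := (`[0%R, 1%R[%classic : set (measurableTypeR R)).
Local Notation mu := (atomic L : {measure set (measurableTypeR R) -> \bar R}).
Local Notation mass := (fine (mu Z)).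

Let mZ : measurable Z. Proof. exact: measurable_itv. Qed.

Let Z0 : Z `<=` `[0, 1]%classic.
Proof. by move=> x /=; rewrite !in_itv /= => /andP[-> /ltW]. Qed.

Let xZ (g : word b) : Z (xval R g).
Proof.
rewrite /= in_itv /= xval_ge0 /=; apply: lt_le_trans (xval_le R b_gt1 g).
by rewrite ltrDl bpow_gt0.
Qed.

Let muZ : (mu Z < +oo)%E.
Proof.
apply: le_lt_trans L_fin; apply: le_esum => g _.
rewrite -[leRHS]mule1; apply: lee_wpmul2l; first by rewrite lee_fin bpow_ge0.
by rewrite diracE; case: (_ \in _); rewrite ?lee_fin.
Qed.



Lemma tail_sumE n : (0 < n)%N ->
  tail_sum R L n = (\int[mu]_(x in Z) invpow n 1 x)%:E.
Proof.
move=> n0; have mf : measurable_fun Z (invpow n 1 : measurableTypeR R -> measurableTypeR R).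
  by apply: (measurable_funS measurableT) => //; exact: measurable_invpow.
rewrite fineK.
  rewrite integral_atomic//; last by move=> x _; exact: invpow_ge0.
  by apply: eq_esum => g _; rewrite /invpow ger0_norm ?xval_ge0// expr1.
apply: integrable_fin_num => //.
apply: (bounded_integrable mZ muZ (M := 1)) => // x _.
by rewrite ger0_norm ?invpow_ge0 ?invpow_le1.
Qed.

Lemma poly_integral_eigen_le (C e : R) m : 0 <= C -> 0 <= e ->
  (forall x, 0 <= x <= 1 -> `|(B m).[x]| <= C * e ^+ m) ->
  `|poly_integral mu Z (B m)| <= C * e ^+ m * mass.
Proof.
move=> C0 e0 BC; apply: ler_norm_poly_integral => // x /Z0 /=.
by rewrite in_itv; exact: BC.
Qed.

(** The expansion is uniform on [0,1], so integrating it against a finite measure only costs the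
    mass. *)
Lemma tail_series_approx n (C K e t z : R) : (0 < n)%N ->
  0 <= C -> 0 <= e -> 0 <= t -> e * t <= z -> z < 1 ->
  (forall m x, 0 <= x <= 1 -> `|(B m).[x]| <= C * e ^+ m) ->
  (forall m, Aint nu m.+1 n <= K * t ^+ m) ->
  forall M, `|\int[mu]_(x in Z) invpow n 1 x -
      \sum_(m < M) (-1) ^+ m * Aint nu m.+1 n * poly_integral mu Z (B m)|
    <= (C * K / (1 - z) * mass) * z ^+ M.
Proof.
move=> n0 C0 e0 t0 etz z1 BC AK M.
pose P := \sum_(m < M) ((-1) ^+ m * Aint nu m.+1 n) *: B m.
have -> : \sum_(m < M) (-1) ^+ m * Aint nu m.+1 n * poly_integral mu Z (B m) = poly_integral mu Z P.
  rewrite /P (poly_integral_sum mZ muZ Z0); apply: eq_bigr => m _.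
  by rewrite (poly_integralZ mZ muZ Z0).
have mf : measurable_fun Z (invpow n 1 : measurableTypeR R -> measurableTypeR R).
  by apply: (measurable_funS measurableT) => //; exact: measurable_invpow.
rewrite /poly_integral -RintegralB//; last 2 first.
- apply: (bounded_integrable mZ muZ (M := 1)) => // x _.
  by rewrite ger0_norm ?invpow_ge0 ?invpow_le1.
- exact: horner_integrable mZ muZ Z0 P.
rewrite mulrAC [_ * z ^+ M](_ : _ = C * K * z ^+ M / (1 - z)); last by rewrite mulrAC.
apply: ler_norm_Rintegral => //.
  by apply: measurable_funB => //; exact: measurable_horner.
move=> x /Z0 /=; rewrite in_itv /= => x01.
rewrite invpowE// expr1 /P horner_sum.
under eq_bigr do rewrite hornerZ.
by apply: (eigen_series_approx b_gt1 w_gt0 nuP BP n0 C0 e0 t0 etz z1 BC AK).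
Qed.

End AtomicSeries.

Theorem theorem5 (R : realType) (b : nat) (hb : (2 <= b)%N)
    (w : word b) (hp : (0 < size w)%N) (hw : ~~ is_zero_word w)
    (nu : nat -> probability (measurableTypeR R) R)
    (hnu : forall j : nat, (1 <= j)%N -> is_nu w j (nu j))
    (B : nat -> {poly R})
    (hB : forall m : nat, is_B w m (B m)) :
  irwin R w = (limn (series (term w nu B)))%:E /\
  exists theta : R, 0 < theta < 1 /\
    term w nu B =O_\oo (fun m : nat => theta ^+ m).
Proof.
have [g0 Gg0 g0s] := langG_shortest hp.
have g0min g : langG w g -> (size g0 <= size g)%N.
  by move=> /g0s[u -> _]; rewrite size_cat leq_addl.
pose p : R := b%:R ^+ size g0.
have p0 : 0 < p by rewrite exprn_gt0// ltr0n ltnW.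
pose t := p / (p + 1).
have t0 : 0 < t by rewrite divr_gt0//; lra.
have t1 : t < 1 by rewrite ltr_pdivrMr; lra.
(* The growth rate 1+d is chosen to leave (1+d)t = t + t(1-t)/2 <= (1+t)/2 = z < 1. *)
pose d := (1 - t) / 2; pose z := (1 + t) / 2.
have z0 : 0 <= z by rewrite /z; lra.
have z1 : z < 1 by rewrite /z; lra.
have etz : (1 + d) * t <= z by rewrite /d /z; nra.
have d0 : 0 < d by rewrite /d; lra.
have [C C0 BC] := eigenpoly_bound hb hp hnu hB Gg0 g0s d0.
pose K := p * lambda R w 1.
have AK a m : (0 < a)%N -> Aint nu m.+1 a <= K * t ^+ m.
  by move=> a0; exact: (Aint_le hb hp hw hnu a0 m Gg0 g0min).
have e0 : 0 <= 1 + d by lra.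
(* As w is not a zero word, n(w) is positive even when w_1 = 0, so the w-term is estimated without
   distinguishing cases. *)
have nw : (0 < nval w)%N by rewrite lt0n nval_eq0.
pose Z : set (measurableTypeR R) := `[0%R, 1%R[%classic.
have Ffin := langF_mass hp R hb; have Rfin := langR_mass hp R hb.
pose J (L : set (word b)) a : R := \int[atomic L]_(x in Z) invpow a 1 x.
pose S (L : set (word b)) a M : R :=
  \sum_(m < M) (-1) ^+ m * Aint nu m.+1 a * poly_integral (atomic L) Z (B m).
have z01 : 0 <= z < 1 by rewrite z0.
have SJ L a : (\esum_(g in L) (b%:R ^- size g : R)%:E < +oo)%E -> (0 < a)%N ->
    S L a @ \oo --> J L a.
  move=> Lfin a0; apply: (cvg_geometric_bound z01).
  exact: (tail_series_approx hb hp hnu hB Lfin a0 C0 e0 (ltW t0) etz z1 BC (AK a ^~ a0)).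
pose del : R := (first_digit w != 0%N)%:R.
pose I : R := \sum_(1 <= a < b) J (langF w) a - del * J (langR w) (nval w).
have seriesE : series (term w nu B) = fun M =>
    \sum_(1 <= a < b) S (langF w) a M - del * S (langR w) (nval w) M.
  apply/funext => M; rewrite /series /= big_mkord /S exchange_big /= mulr_sumr -sumrB.
  apply: eq_bigr => m _; rewrite /term mulrBr; congr (_ - _).
    by rewrite mulr_sumr; apply: eq_bigr => a _; rewrite mulrA.
  (* [Rint] at m+1 integrates the polynomial of index [m.+1.-1], which computes to m. *)
  have -> : Defs.Rint w B m.+1 = poly_integral (atomic (langR w)) Z (B m) by [].
  by rewrite /del; ring.
have cS : series (term w nu B) @ \oo --> I.
  rewrite seriesE; apply: cvgB.
    rewrite big_add1; under eq_fun do rewrite big_add1.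
    by apply: cvg_bigsum => a; exact: SJ.
  by apply: cvgMl_tmp; exact: SJ.
split.
  rewrite (cvg_lim _ cS)//.
  (* The subtracted term is finite, so the identity in the extended reals can be solved for
     I(b,w,0). *)
  have := irwin_tail_sum R hb hp.
  rewrite (tail_sumE hb Rfin nw) -/(J (langR w) (nval w)).
  rewrite (_ : (if _ then _ else _) = (del * J (langR w) (nval w))%:E); last first.
    by rewrite /del; case: ifP => _; rewrite ?mul1r ?mul0r.
  have -> : (\sum_(1 <= a < b) tail_sum R (langF w) a =
      (\sum_(1 <= a < b) J (langF w) a)%:E)%E.
    rewrite -sumEFin; apply: eq_big_nat => a /andP[a0 _].
    exact: (tail_sumE hb Ffin a0).
  by move=> e; rewrite /I EFinB -e addeK.
exists z; split; first by rewrite z1 andbT /z; lra.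
have bnd (L : set (word b)) a m : (\esum_(g in L) (b%:R ^- size g : R)%:E < +oo)%E ->
    (0 < a)%N -> `|Aint nu m.+1 a * poly_integral (atomic L) Z (B m)| <=
    K * C * fine (atomic L Z) * z ^+ m.
  move=> Lfin a0; rewrite normrM ger0_norm ?Aint_ge0//.
  have h := poly_integral_eigen_le hb Lfin C0 e0 (BC m).
  apply: (le_trans (y := K * t ^+ m * (C * (1 + d) ^+ m * fine (atomic L Z)))).
    by apply: ler_pM; rewrite ?Aint_ge0//; exact: AK.
  have mass0 : 0 <= fine (atomic L Z) by rewrite fine_ge0// measure_ge0.
  have K0 : 0 <= K by rewrite mulr_ge0 ?lambda_ge0// ltW.
  rewrite (_ : K * t ^+ m * (C * (1 + d) ^+ m * fine (atomic L Z)) =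
    K * C * fine (atomic L Z) * ((1 + d) * t) ^+ m); last by rewrite [((1 + d) * t) ^+ m]exprMn; ring.
  apply: ler_wpM2l; first exact: mulr_ge0 (mulr_ge0 K0 C0) mass0.
  by rewrite lerXn2r ?nnegrE//; exact: mulr_ge0 e0 (ltW t0).
pose k := \sum_(1 <= a < b) K * C * fine (atomic (langF w) Z) +
  K * C * fine (atomic (langR w) Z).
apply/eqO_exP; exists (`|k| + 1); first by rewrite ltr_wpDl.
apply: nearW => m; rewrite /= (ger0_norm (exprn_ge0 m z0)).
apply: (le_trans (y := k * z ^+ m)); last first.
  by rewrite ler_wpM2r ?exprn_ge0//; apply: le_trans (ler_norm _) _; rewrite lerDl.
rewrite /term normrM normrX normrN1 expr1n mul1r /k mulrDl.
apply: le_trans (ler_normB _ _) _; apply: lerD.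
  rewrite mulr_suml big_nat [leRHS]big_nat; apply: le_trans (ler_norm_sum _ _ _) _.
  by apply: ler_sum => a /andP[a0 _]; exact: bnd.
have -> : Defs.Rint w B m.+1 = poly_integral (atomic (langR w)) Z (B m) by [].
rewrite -mulrA normrM; apply: le_trans (bnd (langR w) (nval w) m Rfin nw).
by rewrite ler_piMl// normr_nat; case: (_ != _).
Qed.
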